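(* Let $(M^n,g)$ be a Riemannian manifold, let $g_+$ be an even Poincaré metric in normal form relative to $g$ on $\mathring X=M\times(0,\epsilon_0)_r$, and let $\widetilde g$ be the corresponding straight ambient metric in normal form on $\widetilde{\mathcal G}=\mathbb R_+\times M\times(-\epsilon,\epsilon)_\rho$. A submanifold $Y\subset\mathring X$ with $1\le\dim Y\le\dim X-1$ is minimal with respect to $g_+$ if and only if its homogeneous lift $\overline Y$ is minimal with respect to $\widetilde g$.
   Context: **Even Poincaré metric.** $g_+=r^{-2}(dr^2+g_r)$ on $\mathring X$, where $X=M\times[0,\epsilon_0)_r$, $g_r$ is a smooth 1-parameter family of metrics on $M$ with $g_0=g$ and even Taylor expansion at $r=0$, such that $\mathrm{Ric}(g_+)+ng_+$ vanishes to infinite order at $r=0$ if $n$ is odd, and $|\mathrm{Ric}(g_+)+ng_+|_{g_+}=O(r^n)$ if $n$ is even. **Ambient metric.** Points of $\widetilde{\mathcal G}$ are written $(t,p,\rho)$. The corresponding straight ambient metric is the Lorentzian metric $\widetilde g=2\rho\,dt^2+2t\,dt\,d\rho+t^2\mathrm g_\rho$, where $\mathrm g_\rho$ is a smooth 1-parameter family of metrics on $M$ with $\mathrm g_0=g$, related to $g_r$ on $\{\rho\le0\}$ by $g_r=\mathrm g_{-r^2/2}$, i.e. $r=\sqrt{-2\rho}$. With $s=rt$ on $\{\rho<0\}$ one has $\widetilde g=s^2g_+-ds^2$ in the variables $(s,p,r)$. **Homogeneous lift.** Define the projection $\pi_X(t,p,\rho)=(p,\sqrt{-2\rho})$ from $\{\rho\le0\}\subset\widetilde{\mathcal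 G}$ to $X$. The homogeneous lift of $Y$ is $\overline Y=\pi_X^{-1}(Y)\cong\mathbb R_+\times Y$; it is invariant under the dilations $(t,p,\rho)\mapsto(st,p,\rho)$, $s>0$, and $\widetilde g|_{T\overline Y}$ has Lorentzian signature. A nondegenerate submanifold is minimal if its mean curvature vector vanishes. *)

(* Defs.v *)
From HB Require Import structures.
From mathcomp Require Import all_boot all_order all_algebra.
From mathcomp Require Import all_classical all_reals all_analysis.

Set Implicit Arguments.
Unset Strict Implicit.
Unset Printing Implicit Defensive.
Import Order.TTheory GRing.Theory Num.Theory.
Import numFieldNormedType.Exports.
Local Open Scope classical_set_scope.
Local Open Scope ring_scope.

Section Smoothness.
Context {R : realType}.

Definition partial {m} {W : normedModType R} (i : 'I_m) (f : 'rV[R]_m -> W) :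
  'rV[R]_m -> W := fun x => 'D_(delta_mx 0 i) f x.

Definition iter_partial {m} {W : normedModType R} (s : seq 'I_m)
  (f : 'rV[R]_m -> W) : 'rV[R]_m -> W := foldr partial f s.

(* C^infty on an open set U: the iterated partial derivatives of all orders
   exist and are differentiable on U *)
Definition smooth_on {m} {W : normedModType R} (U : set 'rV[R]_m)
    (f : 'rV[R]_m -> W) : Prop :=
  forall (s : seq 'I_m) x, U x -> differentiable (iter_partial s f) x.

(* On a set S that need not be open (a half-space): h is a smooth extension of
   f|_S to the open set V. *)
Definition smooth_extension {m} {W : normedModType R} (S V : set 'rV[R]_m)
    (f h : 'rV[R]_m -> W) : Prop :=
  [/\ open V, smooth_on V h & forall x, V x -> S x -> f x = h x].

Definition smooth_upto {m} {W : normedModType R} (S : set 'rV[R]_m)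
    (f : 'rV[R]_m -> W) : Prop :=
  forall x, S x -> exists V h, V x /\ smooth_extension S V f h.

End Smoothness.

Section Manifolds.
Context {R : realType}.

Record chart (T : topologicalType) (m : nat) := Chart {
  cdom : set T;
  cmap : T -> 'rV[R]_m;
  cinv : 'rV[R]_m -> T }.

Definition cimg T m (c : chart T m) : set 'rV[R]_m := cmap c @` cdom c.

Definition is_chart T m (c : chart T m) : Prop :=
  [/\ open (cdom c) /\ open (cimg c),
      forall p, cdom c p -> cinv c (cmap c p) = p,
      forall p, cdom c p -> {for p, continuous (cmap c)} &
      forall x, cimg c x -> {for x, continuous (cinv c)}].

Definition overlap T m (c d : chart T m) : set 'rV[R]_m :=
  cmap c @` (cdom c `&` cdom d).

Definition transition T m (c d : chart T m) : 'rV[R]_m -> 'rV[R]_m :=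
  cmap d \o cinv c.

Record manifold (n : nat) := Manifold {
  mspace :> topologicalType;
  mindex : Type;
  matlas : mindex -> chart mspace n;
  manifold_hausdorff : hausdorff_space mspace;
  manifold_countable : @second_countable mspace;
  manifold_chart : forall i, is_chart (matlas i);
  manifold_cover : forall p, exists i, cdom (matlas i) p;
  manifold_smooth : forall i j, smooth_on (overlap (matlas i) (matlas j))
                                  (transition (matlas i) (matlas j)) }.

(* A covariant 2-tensor is given by its component matrices in the charts. *)
Definition components (I : Type) (m : nat) := I -> 'rV[R]_m -> 'M[R]_m.

Definition posdef m (G : 'M[R]_m) : Prop :=
  G^T = G /\ forall v : 'rV[R]_m, v != 0 -> 0 < (v *m G *m v^T) 0 0.

(* Tangent vectors are rows and 'J acts on the right, so the components of the
   pull-back of G under f are J G J^T. *)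
Definition riemannian_metric n (M : manifold n)
    (g : components (mindex M) n) : Prop :=
  [/\ forall i, smooth_on (cimg (matlas i)) (g i),
      forall i x, cimg (matlas i) x -> posdef (g i x) &
      forall i j x, overlap (matlas i) (matlas j) x ->
        let tau := transition (matlas i) (matlas j) in
        g i x = 'J tau x *m g j (tau x) *m ('J tau x)^T].

End Manifolds.

Arguments chart R T m : clear implicits.
Arguments manifold R n : clear implicits.
Arguments components R I m : clear implicits.

Section LocalGeometry.
Context {R : realType} {m : nat}.
Implicit Type g : 'rV[R]_m -> 'M[R]_m.

(* christoffel g i j l x is Gamma^i_{jl} at x *)
Definition christoffel g (i j l : 'I_m) (x : 'rV[R]_m) : R :=
  2^-1 * \sum_(p < m) invmx (g x) i p *
    (partial j (fun y => g y l p) x + partial l (fun y => g y j p) x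
     - partial p (fun y => g y j l) x).

Definition ricci g (x : 'rV[R]_m) : 'M[R]_m :=
  \matrix_(j, l)
    (\sum_(i < m) (partial i (christoffel g i j l) x
                   - partial j (christoffel g i i l) x)
     + \sum_(i < m) \sum_(p < m)
         (christoffel g i i p x * christoffel g p j l x
          - christoffel g i j p x * christoffel g p i l x)).

(* |E|_G for a covariant 2-tensor E *)
Definition tensor_norm (G E : 'M[R]_m) : R :=
  Num.sqrt (\tr (invmx G *m E *m invmx G *m E^T)).

Section Immersion.
Context {k : nat}.
Variables (g : 'rV[R]_m -> 'M[R]_m) (F : 'rV[R]_k -> 'rV[R]_m).

Definition first_form (u : 'rV[R]_k) : 'M[R]_k :=
  'J F u *m g (F u) *m ('J F u)^T.

Definition normal_part (u : 'rV[R]_k) (v : 'rV[R]_m) : 'rV[R]_m :=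
  v - v *m g (F u) *m ('J F u)^T *m invmx (first_form u) *m 'J F u.

(* the covariant derivative of d_b F in the direction d_a F *)
Definition cov_deriv (a b : 'I_k) (u : 'rV[R]_k) : 'rV[R]_m :=
  \row_i (partial a (partial b (fun w => F w 0 i)) u
          + \sum_(j < m) \sum_(l < m)
              christoffel g i j l (F u) * 'J F u a j * 'J F u b l).

Definition second_form (a b : 'I_k) (u : 'rV[R]_k) : 'rV[R]_m :=
  normal_part u (cov_deriv a b u).

(* tr_h II, not divided by k *)
Definition mean_curvature (u : 'rV[R]_k) : 'rV[R]_m :=
  \sum_(a < k) \sum_(b < k) invmx (first_form u) a b *: second_form a b u.

End Immersion.
End LocalGeometry.

Section Submanifolds.
Context {R : realType} {T : topologicalType} {I : Type} {m : nat}.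
Variable A : I -> chart R T m.

(* A smooth immersion F : V -> T that is a homeomorphism onto a relatively open
   part of Y. *)
Definition local_param (k : nat) (Y : set T) (V : set 'rV[R]_k)
    (F : 'rV[R]_k -> T) : Prop :=
  [/\ open V /\ (forall u, V u -> {for u, continuous F}),
      exists2 W, open W & F @` V = Y `&` W,
      exists2 G : T -> 'rV[R]_k, {within F @` V, continuous G} &
        forall u, V u -> G (F u) = u,
      forall i, smooth_on (V `&` F @^-1` cdom (A i)) (cmap (A i) \o F) &
      forall i u, V u -> cdom (A i) (F u) ->
        \rank ('J (cmap (A i) \o F) u) = k].

(* embedded, without boundary, of dimension k, in the open subset of T covered
   by A *)
Definition submanifold (k : nat) (Y : set T) : Prop :=
  (forall p, Y p -> exists i, cdom (A i) p) /\
  (forall p, Y p -> exists V F, local_param (k := k) Y V F /\ (F @` V) p).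

Definition nondegenerate (g : components R I m) (k : nat) (Y : set T) : Prop :=
  forall V F, local_param (k := k) Y V F ->
  forall i u, V u -> cdom (A i) (F u) ->
    first_form (g i) (cmap (A i) \o F) u \in unitmx.

Definition minimal (g : components R I m) (k : nat) (Y : set T) : Prop :=
  [/\ submanifold k Y, nondegenerate g k Y &
      forall V F, local_param (k := k) Y V F ->
      forall i u, V u -> cdom (A i) (F u) ->
        mean_curvature (g i) (cmap (A i) \o F) u = 0].

End Submanifolds.

Section PoincareAmbient.
Context {R : realType} {n : nat}.
Variable M : manifold R n.

Local Notation comps := (components R (mindex M) n).
Local Notation img i := (cimg (matlas (m := M) i)).

(* M x (0, e0), with coordinates (x, r) *)
Definition poincare_atlas (e0 : R) (i : mindex M) :
    chart R (M * R)%type (n + 1) :=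
  Chart [set q : M * R | cdom (matlas i) q.1 /\ 0 < q.2 < e0]
        (fun q : M * R => row_mx (cmap (matlas i) q.1) q.2%:M)
        (fun z => (cinv (matlas i) (lsubmx z), rsubmx z 0 0)).

(* R_+ x M x (-e, e), with coordinates (t, x, rho) *)
Definition ambient_atlas (e : R) (i : mindex M) :
    chart R (R * M * R)%type (1 + n + 1) :=
  Chart [set q : R * M * R |
           [/\ 0 < q.1.1, cdom (matlas i) q.1.2 & - e < q.2 < e]]
        (fun q : R * M * R =>
           row_mx (row_mx q.1.1%:M (cmap (matlas i) q.1.2)) q.2%:M)
        (fun z => (lsubmx (lsubmx z) 0 0, cinv (matlas i) (rsubmx (lsubmx z)),
                   rsubmx z 0 0)).

Definition poincare_metric (gr : R -> comps) :
    components R (mindex M) (n + 1) :=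
  fun i z => let x := lsubmx z in let r := rsubmx z 0 0 in
  (r ^- 2) *: block_mx (gr r i x) 0 0 1%:M.

(* 2 rho dt^2 + 2 t dt drho + t^2 g_rho *)
Definition ambient_metric (grho : R -> comps) :
    components R (mindex M) (1 + n + 1) :=
  fun i z =>
  let t := lsubmx (lsubmx z) 0 0 in
  let x := rsubmx (lsubmx z) in
  let rho := rsubmx z 0 0 in
  block_mx (block_mx (2 * rho)%:M 0 0 (t ^+ 2 *: grho rho i x))
           (col_mx t%:M 0)
           (row_mx t%:M 0) 0.

(* the r-derivatives of odd order vanish at r = 0 *)
Definition even_at0 (S : set 'rV[R]_(n + 1)) (f : 'rV[R]_(n + 1) -> 'M[R]_n) :
    Prop :=
  forall V h, smooth_extension S V f h ->
  forall (l : nat) z, odd l -> V z -> S z -> rsubmx z = 0 ->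
    iter_partial (nseq l (rshift n ord0)) h z = 0.

Definition einstein_tensor (gr : R -> comps) (i : mindex M)
    (z : 'rV[R]_(n + 1)) : 'M[R]_(n + 1) :=
  ricci (poincare_metric gr i) z + n%:R *: poincare_metric gr i z.

(* f = O(r^N) as r -> 0+, locally uniformly on M *)
Definition bigO_r (i : mindex M) (N : nat) (f : 'rV[R]_(n + 1) -> R) : Prop :=
  forall x, img i x -> exists C : R,
    \forall z \near row_mx x (0 : 'M[R]_1),
      0 < rsubmx z 0 0 -> `|f z| <= C * rsubmx z 0 0 ^+ N.

Definition even_poincare (g : comps) (e0 : R) (gr : R -> comps) : Prop :=
  [/\ forall r, 0 <= r < e0 -> riemannian_metric (gr r),
      forall i x, img i x -> gr 0 i x = g i x,
      forall i,
        let S := [set z | img i (lsubmx z) /\ 0 <= rsubmx z 0 0 < e0] in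
        let f := fun z => gr (rsubmx z 0 0) i (lsubmx z) in
        smooth_upto S f /\ even_at0 S f,
      odd n -> forall i (N : nat) (a b : 'I_(n + 1)),
        bigO_r i N (fun z => einstein_tensor gr i z a b) &
      ~~ odd n -> forall i,
        bigO_r i n (fun z => tensor_norm (poincare_metric gr i z)
                                         (einstein_tensor gr i z))].

Definition corresponding_ambient (g : comps) (e0 : R) (gr : R -> comps)
    (e : R) (grho : R -> comps) : Prop :=
  [/\ forall rho, - e < rho < e -> riemannian_metric (grho rho),
      forall i x, img i x -> grho 0 i x = g i x,
      forall i, smooth_on
        [set z | img i (lsubmx z) /\ - e < rsubmx z 0 0 < e]
        (fun z : 'rV[R]_(n + 1) => grho (rsubmx z 0 0) i (lsubmx z)) &
      forall r i x, 0 <= r < e0 -> img i x ->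
        gr r i x = grho (- (r ^+ 2 / 2)) i x].

(* maps into M x [0, e0) only where rho > - e0^2 / 2; the preimage of a subset of
   M x (0, e0) does not see the other points *)
Definition ambient_proj (q : R * M * R) : M * R :=
  (q.1.2, Num.sqrt (- 2 * q.2)).

Definition homogeneous_lift (e : R) (Y : set (M * R)) : set (R * M * R) :=
  [set q | 0 < q.1.1 /\ - e < q.2 <= 0] `&` ambient_proj @^-1` Y.

End PoincareAmbient.

Arguments poincare_atlas {R n} M e0 i.
Arguments ambient_atlas {R n} M e i.

(* Main.v *)
(* In the coordinates (s, p, r) with s = r t and r^2 = - 2 rho, the ambient metric is
   the Lorentzian cone metric s^2 g_+ - ds^2, and the homogeneous lift of Y is the
   cone over Y.  A local parametrization F of Y gives (s, u) |-> (s, F u) for the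
   lift.  Its first fundamental form is diag(-1, s^2 h), the covariant derivative of
   d_s along itself vanishes, and the covariant derivatives in two directions of Y are
   those of Y plus a multiple of d_s, which is tangent to the cone.  Hence the traces
   of the two second fundamental forms agree up to the factor s^-2 and a tangential
   term, and one has no normal component iff the other has none.  The argument is
   carried out in the coordinates (t, p, rho) by pairing covariant derivatives with
   test vectors.  An arbitrary parametrization of the lift is compared with the cone
   one by a change of parameters. *)
Require Import Defs.
From HB Require Import structures.
From mathcomp Require Import all_boot all_order all_algebra.
From mathcomp Require Import all_classical all_reals all_analysis.
From mathcomp Require Import ring lra.
Set Implicit Arguments.
Unset Strict Implicit.
Unset Printing Implicit Defensive.
Import Order.TTheory GRing.Theory Num.Theory.
Import numFieldNormedType.Exports.
Local Open Scope classical_set_scope.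
Local Open Scope ring_scope.

(** * Differential calculus in coordinates *)

Section Differentiability.
Context {R : realType}.

(** [minimal] quantifies over all local parametrizations and all charts of a fixed atlas, which
    shapes the proof. The ambient charts use (t, p, rho); staying in them means that no
    transformation law for Christoffel symbols is needed. The variables (s, p, r) enter only through
    [cone_tangent], which at each point gives a basis adapted to the splitting of the cone metric.
    Near a point [gr] is replaced by [grho] at rho = - r^2 / 2, so that the derivatives of one and
    the same family occur on both sides as unknown scalars, and comparing covariant derivatives
    becomes an identity of rational functions. The remaining freedom lies in the parameters. To
    descend from the lift to Y, cone parametrizations suffice. To go up, an arbitrary
    parametrization has to be treated, and since mean curvature contains second derivatives, the
    change of parameters must be differentiated twice. Positivity of g_+ makes first forms on Y
    invertible; the ambient metric is indefinite, so the lift inherits its nondegeneracy from Y. *)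

Lemma near_eq_differentiable (V W : normedModType R) (f g : V -> W) x :
  (\near x, f x = g x) -> differentiable f x -> differentiable g x.
Proof.
move=> fg df.
have E : g \o shift x = cst (g x) + 'd f x +o_ (0 : V) id.
  apply/eqaddoP => _/posnumP[e].
  have /eqaddoP/(_ e%:num [gt0 of e%:num]) := diff_locally df.
  rewrite -(nbhs_singleton fg); apply: filter_app.
  have : \forall y \near 0, f (shift x y) = g (shift x y).
    by move: fg; rewrite (near_shift 0 x) /= subr0.
  by apply: filterS => y /= yE; rewrite !fctE /= -yE.
have dfc := diff_continuous df.
(* [E] expands [g] with the differential of [f]; uniqueness of the linear part turns it into the
   expansion with ['d g x]. *)
by apply/diff_locallyP; rewrite (diff_unique dfc E).
Qed.

Lemma near_eq_partial m (W : normedModType R) (f g : 'rV[R]_m -> W) i x :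
  (\near x, f x = g x) -> partial i f x = partial i g x.
Proof. exact: near_eq_derive. Qed.

Lemma near_eq_near (T : topologicalType) (U : Type) (f g : T -> U) (x : T) :
  (\near x, f x = g x) -> \forall y \near x, \near y, f y = g y.
Proof. by move=> /nbhs_interior. Qed.

Lemma differentiable_mxP (V : normedModType R) m n (f : V -> 'M[R]_(m, n)) x :
  differentiable f x <-> forall i j, differentiable (fun y => f y i j) x.
Proof.
split=> [df i j|df].
  exact: (differentiable_comp df (differentiable_coord _ i j)).
have -> : f = \sum_(i < m) \sum_(j < n) (fun y => f y i j *: delta_mx i j).
  apply/funext => y; rewrite [LHS]matrix_sum_delta fct_sumE.
  by apply: eq_bigr => i _; rewrite fct_sumE.
apply: differentiable_sum => i; apply: differentiable_sum => j.
exact: differentiableZl.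
Qed.

Lemma is_derive_mx (V : normedModType R) m n (f : V -> 'M[R]_(m, n)) x v (D : 'M[R]_(m, n)) :
  (forall i j, is_derive x v (fun y => f y i j) (D i j)) -> is_derive x v f D.
Proof.
move=> df; have dv : derivable f x v by apply/derivable_mxP => i j; case: (df i j).
split=> //; rewrite derive_mx //; apply/matrixP => i j.
by rewrite mxE; case: (df i j).
Qed.

Lemma is_derive_coord (V : normedModType R) m n (f : V -> 'M[R]_(m, n)) x v (D : 'M[R]_(m, n)) i j :
  is_derive x v f D -> is_derive x v (fun y => f y i j) (D i j).
Proof.
move=> [dv <-]; have := dv; move/derivable_mxP => dvij.
by split=> //; rewrite derive_mx // mxE.
Qed.

Lemma diff_is_derive (V W : normedModType R) (f : V -> W) x v :
  differentiable f x -> is_derive x v f ('d f x v).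
Proof. by move=> df; split; [exact: diff_derivable | rewrite deriveE]. Qed.

Lemma is_derive_unique (V W : normedModType R) (f : V -> W) x v D D' :
  is_derive x v f D -> is_derive x v f D' -> D = D'.
Proof. by move=> [_ <-] [_ <-]. Qed.

Lemma jacobianE k m (f : 'rV[R]_k -> 'rV[R]_m) u a j :
  differentiable f u -> 'J f u a j = partial a (fun w => f w 0 j) u.
Proof.
move=> df; rewrite /jacobian /partial mxE.
by have [_ ->] := is_derive_coord 0 j (diff_is_derive (delta_mx 0 a) df).
Qed.

Lemma row_jacobian k m (f : 'rV[R]_k -> 'rV[R]_m) u a :
  row a ('J f u) = 'd f u (delta_mx 0 a).
Proof. by rewrite rowE /jacobian mul_rV_lin1. Qed.

Lemma near_eq_jacobian k m (f g : 'rV[R]_k -> 'rV[R]_m) u :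
  differentiable f u -> (\near u, f u = g u) -> 'J f u = 'J g u.
Proof.
move=> df fg; have dg := near_eq_differentiable fg df.
apply/row_matrixP => a.
apply: etrans (row_jacobian f u a) _; apply: etrans _ (esym (row_jacobian g u a)).
apply: etrans (esym (deriveE _ df)) _; apply: etrans _ (deriveE _ dg).
exact: near_eq_derive.
Qed.

Lemma differentiable_bigprod (V : normedModType R) (I : Type) (s : seq I)
    (f : I -> V -> R) x :
  (forall i, differentiable (f i) x) ->
  differentiable (fun y => \prod_(i <- s) f i y) x.
Proof.
move=> df; elim: s => [|i s IH].
  rewrite (_ : (fun _ => _) = cst 1) //.
  by apply/funext => y; rewrite big_nil.
rewrite (_ : (fun _ => _) = f i * (fun y => \prod_(j <- s) f j y)).
  exact: differentiableM.
by apply/funext => y; rewrite big_cons.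
Qed.

Lemma differentiable_bigsum (V W : normedModType R) (I : Type) (s : seq I)
    (f : I -> V -> W) x :
  (forall i, differentiable (f i) x) ->
  differentiable (fun y => \sum_(i <- s) f i y) x.
Proof.
move=> df; elim: s => [|i s IH].
  rewrite (_ : (fun _ => _) = cst 0) //.
  by apply/funext => y; rewrite big_nil.
rewrite (_ : (fun _ => _) = f i + (fun y => \sum_(j <- s) f j y)).
  exact: differentiableD.
by apply/funext => y; rewrite big_cons.
Qed.

Lemma differentiable_det (V : normedModType R) n (f : V -> 'M[R]_n) x :
  differentiable f x -> differentiable (fun y => \det (f y)) x.
Proof.
move=> /differentiable_mxP df; apply: differentiable_bigsum => s.
by apply: differentiableZ; apply: differentiable_bigprod.
Qed.

(** Cramer's rule. Invertibility is asked near [x] because [invmx] returns its argument on a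
    singular matrix. *)
Lemma differentiable_invmx (V : normedModType R) n (f : V -> 'M[R]_n) x :
  differentiable f x -> (\near x, f x \in unitmx) ->
  differentiable (fun y => invmx (f y)) x.
Proof.
move=> df fU.
apply: (@near_eq_differentiable _ _ (fun y => (\det (f y))^-1 *: \adj (f y))).
  by apply: filterS fU => y yU; rewrite /invmx yU.
apply/differentiable_mxP => i j.
rewrite (_ : (fun _ => _) =
  (fun y => (\det (f y))^-1) * (fun y => cofactor (f y) j i)); last first.
  by apply/funext => y; rewrite !mxE.
apply: differentiableM.
  apply: differentiableV; first exact: differentiable_det.
  by have := nbhs_singleton fU; rewrite unitmxE unitfE.
apply: differentiableZ; apply: differentiable_det.
apply/differentiable_mxP => a b.
rewrite (_ : (fun _ => _) = (fun y => f y (lift j a) (lift i b))).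
  by move/differentiable_mxP : df.
by apply/funext => y; rewrite !mxE.
Qed.

Lemma differentiable_mulmx (V : normedModType R) m n p
    (f : V -> 'M[R]_(m, n)) (g : V -> 'M[R]_(n, p)) x :
  differentiable f x -> differentiable g x ->
  differentiable (fun y => f y *m g y) x.
Proof.
move=> /differentiable_mxP df /differentiable_mxP dg; apply/differentiable_mxP => i j.
rewrite (_ : (fun _ => _) = (fun y => \sum_l f y i l * g y l j)).
  by apply: differentiable_bigsum => l; apply: differentiableM.
by apply/funext => y; rewrite !mxE.
Qed.

Lemma differentiable_trmx (V : normedModType R) m n (f : V -> 'M[R]_(m, n)) x :
  differentiable f x -> differentiable (fun y => (f y)^T) x.
Proof.
move=> /differentiable_mxP df; apply/differentiable_mxP => i j.
rewrite (_ : (fun _ => _) = (fun y => f y j i)) //.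
by apply/funext => y; rewrite !mxE.
Qed.

End Differentiability.

(** * Smooth maps *)

Section Smoothness.
Context {R : realType} {m : nat}.
Implicit Types (W : normedModType R) (U : set 'rV[R]_m).

(* Truncating the order makes the closure properties of smooth maps provable by
   induction on N. *)
Definition Cn N W U (f : 'rV[R]_m -> W) :=
  forall s, (size s <= N)%N -> forall x, U x -> differentiable (iter_partial s f) x.

Lemma smooth_onP W U (f : 'rV[R]_m -> W) :
  smooth_on U f <-> forall N, Cn N U f.
Proof. by split=> [sf N s _|sf s]; [exact: sf | exact: (sf (size s))]. Qed.

Lemma Cn0 W U (f : 'rV[R]_m -> W) :
  Cn 0 U f <-> forall x, U x -> differentiable f x.
Proof.
split=> [/(_ [::] isT)//|df s].
by rewrite leqn0 size_eq0 => /eqP ->.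
Qed.

(** [iter_partial] applies the last index of the word first, so stripping it with [rcons] leaves an
    iterated partial of [partial i f]. Inductions on [N] therefore keep [f] general. *)
Lemma CnS N W U (f : 'rV[R]_m -> W) :
  Cn N.+1 U f <->
  (forall x, U x -> differentiable f x) /\ forall i, Cn N U (partial i f).
Proof.
split=> [cf|[df cf]].
  split=> [|i s sN]; first exact: (cf [::]).
  by have := cf (rcons s i); rewrite size_rcons ltnS /iter_partial foldr_rcons; exact.
case/lastP => [_|s i]; first exact: df.
rewrite size_rcons ltnS /iter_partial foldr_rcons.
exact: cf.
Qed.

Lemma CnW N W U (f : 'rV[R]_m -> W) : Cn N.+1 U f -> Cn N U f.
Proof. by move=> cf s sN; apply: cf; apply: leqW. Qed.

Lemma Cn_diff N W U (f : 'rV[R]_m -> W) x : Cn N U f -> U x -> differentiable f x.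
Proof. by move=> cf; apply: (cf [::]). Qed.

Lemma Cn_eq N W U (f g : 'rV[R]_m -> W) :
  open U -> (forall x, U x -> f x = g x) -> Cn N U f -> Cn N U g.
Proof.
move=> oU fg cf s sN x Ux.
have E t : forall y, U y -> iter_partial t f y = iter_partial t g y.
  elim: t => [|i t IH] y Uy //=; first exact: fg.
  by apply: near_eq_partial; near=> z; apply: IH; near: z; exact: open_nbhs_nbhs.
apply: (near_eq_differentiable _ (cf s sN x Ux)).
by near=> z; apply: E; near: z; exact: open_nbhs_nbhs.
Unshelve. all: by end_near. Qed.

Lemma Cn_cst N W U (w : W) : Cn N U (cst w).
Proof.
elim: N w => [|N IH] w; first by apply/Cn0.
apply/CnS; split=> // i; rewrite (_ : partial i _ = cst 0) //.
by apply/funext => x; rewrite /partial derive_cst.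
Qed.

Lemma CnD N W U (f g : 'rV[R]_m -> W) :
  open U -> Cn N U f -> Cn N U g -> Cn N U (fun x => f x + g x).
Proof.
move=> oU; elim: N f g => [|N IH] f g.
  move=> /Cn0 df /Cn0 dg; apply/Cn0 => x Ux.
  by apply: differentiableD; [exact: df | exact: dg].
move=> /CnS[df cf] /CnS[dg cg]; apply/CnS; split=> [x Ux|i].
  by apply: differentiableD; [exact: df | exact: dg].
apply: (Cn_eq oU _ (IH _ _ (cf i) (cg i))) => x Ux.
rewrite /partial -deriveD //; apply: diff_derivable; [exact: df | exact: dg].
Qed.

Lemma CnM N U (f g : 'rV[R]_m -> R) :
  open U -> Cn N U f -> Cn N U g -> Cn N U (fun x => f x * g x).
Proof.
move=> oU; elim: N f g => [|N IH] f g.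
  move=> /Cn0 df /Cn0 dg; apply/Cn0 => x Ux.
  by apply: differentiableM; [exact: df | exact: dg].
move=> cf1 cg1; have /CnS[df cf] := cf1; have /CnS[dg cg] := cg1.
apply/CnS; split=> [x Ux|i].
  by apply: differentiableM; [exact: df | exact: dg].
have := CnD oU (IH _ _ (CnW cf1) (cg i)) (IH _ _ (CnW cg1) (cf i)).
apply: Cn_eq => // x Ux; rewrite /partial -[RHS]/(derive (f * g) x _) deriveM //.
- by apply: diff_derivable; exact: df.
- by apply: diff_derivable; exact: dg.
Qed.

Lemma CnV N U (f : 'rV[R]_m -> R) :
  open U -> (forall x, U x -> f x != 0) -> Cn N U f -> Cn N U (fun x => (f x)^-1).
Proof.
move=> oU f0; elim: N f f0 => [|N IH] f f0.
  by move=> /Cn0 df; apply/Cn0 => x Ux; apply: differentiableV; [exact: df | exact: f0].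
move=> cf1; have /CnS[df cf] := cf1; apply/CnS; split=> [x Ux|i].
  by apply: differentiableV; [exact: df | exact: f0].
(* The derivative of the inverse contains the inverse itself, but only up to order [N], which is the
   induction hypothesis for the same [f]. *)
have cV := IH _ f0 (CnW cf1).
have := CnM oU (@Cn_cst N R U (-1)) (CnM oU (CnM oU cV cV) (cf i)).
apply: Cn_eq => // x Ux; rewrite /partial deriveV ?f0 //.
  by rewrite /cst mulN1r -invfM scaleNr.
by apply: diff_derivable; exact: df.
Qed.

Lemma Cn_mxP N p q U (f : 'rV[R]_m -> 'M[R]_(p, q)) : open U ->
  Cn N U f <-> forall i j, Cn N U (fun x => f x i j).
Proof.
move=> oU; elim: N f => [|N IH] f.
  split=> [/Cn0 df i j|cf]; apply/Cn0 => x Ux.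
    by move: (df x Ux) => /differentiable_mxP.
  by apply/differentiable_mxP => i j; apply: (Cn_diff (cf i j)).
have E l x : differentiable f x ->
    forall i j, partial l f x i j = partial l (fun y => f y i j) x.
  move=> df i j; rewrite /partial derive_mx; last exact: diff_derivable.
  by rewrite mxE.
split=> [/CnS[df cf] i j|cf]; apply/CnS; split=> [x Ux|l].
- by move: (df x Ux) => /differentiable_mxP.
- have /IH/(_ i j) := cf l; apply: Cn_eq => // x Ux; apply: E; exact: df.
- by apply/differentiable_mxP => i j; apply: (Cn_diff (cf i j)).
apply/IH => i j; have /CnS[_ /(_ l)] := cf i j; apply: Cn_eq => // x Ux.
by rewrite E //; apply/differentiable_mxP => a b; apply: (Cn_diff (cf a b)).
Qed.

Lemma smooth_on_mxP p q U (f : 'rV[R]_m -> 'M[R]_(p, q)) : open U ->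
  smooth_on U f <-> forall i j, smooth_on U (fun x => f x i j).
Proof.
move=> oU; split=> [/smooth_onP cf i j|cf]; apply/smooth_onP => N.
  by have /(Cn_mxP _ _ oU) := cf N.
by apply/(Cn_mxP _ _ oU) => i j; have /smooth_onP := cf i j.
Qed.

Lemma smooth_on_diff W U (f : 'rV[R]_m -> W) x :
  smooth_on U f -> U x -> differentiable f x.
Proof. by move=> /(_ [::]) sf; exact: sf. Qed.

Lemma smooth_on_partial W U (f : 'rV[R]_m -> W) i :
  smooth_on U f -> smooth_on U (partial i f).
Proof.
by move=> sf s; have := sf (rcons s i); rewrite /iter_partial foldr_rcons.
Qed.

Lemma smooth_on_eq W U (f g : 'rV[R]_m -> W) :
  open U -> (forall x, U x -> f x = g x) -> smooth_on U f -> smooth_on U g.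
Proof.
by move=> oU fg /smooth_onP cf; apply/smooth_onP => N; exact: (Cn_eq oU fg (cf N)).
Qed.

Lemma smooth_on_cst W U (w : W) : smooth_on U (cst w).
Proof. by apply/smooth_onP => N; exact: Cn_cst. Qed.

Lemma smooth_onM U (f g : 'rV[R]_m -> R) :
  open U -> smooth_on U f -> smooth_on U g -> smooth_on U (fun x => f x * g x).
Proof.
by move=> oU /smooth_onP cf /smooth_onP cg; apply/smooth_onP => N; exact: CnM.
Qed.

Lemma smooth_onV U (f : 'rV[R]_m -> R) : open U ->
  (forall x, U x -> f x != 0) -> smooth_on U f -> smooth_on U (fun x => (f x)^-1).
Proof.
by move=> oU f0 /smooth_onP cf; apply/smooth_onP => N; exact: CnV.
Qed.

Lemma smooth_on_coord U i : smooth_on U (fun x => x 0 i).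
Proof.
apply/smooth_onP => -[|N]; first by apply/Cn0 => x _; exact: differentiable_coord.
apply/CnS; split=> [x _|j]; first exact: differentiable_coord.
rewrite (_ : partial j _ = cst ((delta_mx 0 j : 'rV[R]_m) 0 i)).
  exact: Cn_cst.
apply/funext => x; rewrite /partial.
by have [_ ->] := is_derive_coord 0 i (is_derive_id x (delta_mx 0 j)).
Qed.

End Smoothness.

Section SmoothProjection.
Context {R : realType} {l k : nat} {W : normedModType R}.
Implicit Types (f : 'rV[R]_k -> W) (z : 'rV[R]_(l + k)).

(** By linearity of [rsubmx] the two difference quotients are the same function, so the equality
    holds whether or not [f] is differentiable. *)
Lemma derive_rsubmx f z v :
  'D_v (fun y => f (rsubmx y)) z = 'D_(rsubmx v) f (rsubmx z).
Proof.
rewrite /derive; set d := fun h : R => _; set d' := fun h : R => _.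
suff -> : d = d' by [].
by apply/funext => h; rewrite /d /d' /= linearP.
Qed.

Lemma partial_rsubmx a f :
  partial (rshift l a) (fun z => f (rsubmx z)) = fun z => partial a f (rsubmx z).
Proof.
apply/funext => z; rewrite /partial derive_rsubmx.
rewrite (_ : rsubmx (delta_mx 0 (rshift l a)) = delta_mx 0 a) //.
apply/rowP => b; rewrite !mxE eqxx /=; congr (_%:R).
by rewrite (inj_eq (@rshift_inj _ _)).
Qed.

Lemma partial_rsubmx_lshift a f :
  partial (lshift k a) (fun z => f (rsubmx z)) = cst 0.
Proof.
apply/funext => z; rewrite /partial derive_rsubmx.
rewrite (_ : rsubmx (delta_mx 0 (lshift k a)) = 0); first exact: derive0.
by apply/rowP => b; rewrite !mxE eq_rlshift andbF.
Qed.

(** Partials in the added variables vanish and the others have the same form again, which closes the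
    induction on the order. *)
Lemma smooth_on_rsubmx (U : set 'rV[R]_k) f :
  smooth_on U f -> smooth_on [set z | U (rsubmx z)] (fun z => f (rsubmx z)).
Proof.
move=> /smooth_onP cf; apply/smooth_onP => N; elim: N f cf => [|N IH] h cf.
  apply/Cn0 => z Uz; apply: (@differentiable_comp _ _ _ _ rsubmx h); first exact: differentiable_rsubmx.
  exact: (Cn_diff (cf 0%N) Uz).
apply/CnS; split=> [z Uz|i].
  apply: (@differentiable_comp _ _ _ _ rsubmx h); first exact: differentiable_rsubmx.
  exact: (Cn_diff (cf 0%N) Uz).
case: (splitP i) => a ia.
  have -> : i = lshift k a by exact: val_inj.
  by rewrite partial_rsubmx_lshift; exact: Cn_cst.
have -> : i = rshift l a by exact: val_inj.
by rewrite partial_rsubmx; apply: IH => N'; have /CnS[] := cf N'.+1.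
Qed.

End SmoothProjection.

(** * Immersions and their mean curvature *)

Section ParameterChange.
Context {R : realType}.

Lemma differentiable_nearP (V W : normedModType R) (f : V -> W) x :
  differentiable f x -> forall e, 0 < e ->
  \forall y \near x, `|f y - f x - 'd f x (y - x)| <= e * `|y - x|.
Proof.
move=> df e e0; have /eqaddoP/(_ e e0) := diff_locally df.
rewrite [X in _ -> X](near_shift 0 x) /= subr0; apply: filterS => h /=.
by rewrite addrK opprD addrA; apply.
Qed.

Lemma jacobian_nearP k m (f : 'rV[R]_k -> 'rV[R]_m) x :
  differentiable f x -> forall e, 0 < e ->
  \forall y \near x, `|f y - f x - (y - x) *m 'J f x| <= e * `|y - x|.
Proof.
move=> df e /(differentiable_nearP df); apply: filterS => y.
by rewrite /jacobian mul_rV_lin1.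
Qed.

Lemma differentiable_near (V W : normedModType R) (f : V -> W) x
    (L : {linear V -> W}) : continuous L ->
  (forall e, 0 < e -> \forall y \near x, `|f y - f x - L (y - x)| <= e * `|y - x|) ->
  differentiable f x.
Proof.
move=> cL fL; have E : f \o shift x = cst (f x) + L +o_ (0 : V) id.
  apply/eqaddoP => e e0; have := fL e e0.
  rewrite [X in X -> _](near_shift 0 x) /= subr0; apply: filterS => h /=.
  by rewrite addrK opprD addrA; apply.
by apply/diff_locallyP; rewrite (diff_unique cL E).
Qed.

Lemma continuous_mulmxr p m n (P : 'M[R]_(m, n)) :
  continuous (mulmxr P : 'M[R]_(p, m) -> 'M[R]_(p, n)).
Proof.
move=> v; apply: differentiable_continuous.
exact: (@differentiable_mulmx _ _ _ _ _ id (cst P)).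
Qed.

Lemma mulmxr_lipschitz p m n (P : 'M[R]_(m, n)) :
  exists2 K, 0 < K & forall v : 'M[R]_(p, m), `|v *m P| <= K * `|v|.
Proof.
have [K K0 HK] := linear_lipschitz (@continuous_mulmxr p m n P).
by exists K => // v; exact: HK.
Qed.

(** A right inverse [P] of the Jacobian of [f2] solves the two first-order expansions for the
    increment of [phi], so the differential must be multiplication by [J1 *m P]. The error contains
    a term small relative to the unknown increment, which is absorbed. *)
Lemma row_free_differentiable_factor k m (f1 f2 : 'rV[R]_k -> 'rV[R]_m)
    (phi : 'rV[R]_k -> 'rV[R]_k) u0 :
  {for u0, continuous phi} -> (\near u0, f1 u0 = f2 (phi u0)) ->
  differentiable f1 u0 -> differentiable f2 (phi u0) ->
  row_free ('J f2 (phi u0)) -> differentiable phi u0.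
Proof.
move=> cphi f12 df1 df2 /row_freeP[P JP].
move: (jacobian_nearP df1) (jacobian_nearP df2).
move: ('J f1 u0) ('J f2 (phi u0)) JP => J1 J2 JP near1 near2.
have [K K0 HK] := mulmxr_lipschitz 1 P.
have [K1 K10 HK1] := mulmxr_lipschitz 1 (J1 *m P).
apply: (@differentiable_near _ _ _ _ (mulmxr (J1 *m P))).
  exact: continuous_mulmxr.
(* [d * K <= 1/2] allows the absorption in [b2]; [C] is the total constant once the increment of
   [phi] is bounded by [2 * (K1 + 1)] times that of [u]. *)
move=> e e0; pose C := K * (1 + 2 * (K1 + 1)).
have C0 : 0 < C by rewrite mulr_gt0 // addr_gt0 // mulr_gt0 // addr_gt0.
pose d := Num.min (e / C) (2^-1 / K).
have d0 : 0 < d by rewrite lt_min !divr_gt0.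
have dC : d * C <= e by rewrite -ler_pdivlMr // ge_min lexx.
have dK : d * K <= 2^-1 by rewrite -ler_pdivlMr // ge_min lexx orbT.
have n1 := near1 _ d0.
(* Continuity of [phi] pulls the expansion of [f2] at [phi u0] back to a neighbourhood of [u0]. *)
have n2 := cphi _ (near2 _ d0).
near=> u; rewrite /=.
have h1 : `|f1 u - f1 u0 - (u - u0) *m J1| <= d * `|u - u0| by near: u.
have h2 : `|f2 (phi u) - f2 (phi u0) - (phi u - phi u0) *m J2|
    <= d * `|phi u - phi u0| by near: u.
have e1 : f1 u = f2 (phi u) by near: u.
have e2 : f1 u0 = f2 (phi u0) by exact: (nbhs_singleton f12).
move: h1 h2; rewrite e1 e2.
set h := u - u0; set dp := phi u - phi u0; set df := f2 _ - f2 _ => h1 h2.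
have E : dp - h *m (J1 *m P) =
    (df - h *m J1) *m P - (df - dp *m J2) *m P.
  rewrite -mulmxBl.
  have -> : df - h *m J1 - (df - dp *m J2) = dp *m J2 - h *m J1.
    by rewrite opprB addrC addrA subrK.
  by rewrite [RHS]mulmxBl -[dp *m J2 *m P]mulmxA JP mulmx1 mulmxA.
have b1 : `|dp - h *m (J1 *m P)| <= K * (d * `|h|) + K * (d * `|dp|).
  rewrite E; apply: le_trans (ler_normB _ _) _; apply: lerD.
    by apply: le_trans (HK _) _; rewrite ler_pM2l.
  by apply: le_trans (HK _) _; rewrite ler_pM2l.
(* A priori Lipschitz bound: half of the norm of [dp] is moved to the left-hand side. *)
have b2 : `|dp| <= 2 * (K1 + 1) * `|h|.
  have : `|dp| <= K * (d * `|h|) + K * (d * `|dp|) + K1 * `|h|.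
    rewrite -[dp in leLHS](subrK (h *m (J1 *m P))).
    by apply: le_trans (ler_normD _ _) _; apply: lerD.
  have := normr_ge0 h; have := normr_ge0 dp.
  have : d * K * `|dp| <= 2^-1 * `|dp| by rewrite ler_wpM2r.
  have : d * K * `|h| <= 2^-1 * `|h| by rewrite ler_wpM2r.
  have -> : K * (d * `|h|) = d * K * `|h| by ring.
  have -> : K * (d * `|dp|) = d * K * `|dp| by ring.
  move: (d * K * _) (d * K * _) => X Y.
  have -> : 2 * (K1 + 1) * `|h| = 2 * (K1 * `|h|) + 2 * `|h| by ring.
  move: (K1 * _) => Z.
  lra.
apply: (le_trans b1).
have -> : K * (d * `|h|) + K * (d * `|dp|) = d * K * (`|h| + `|dp|) by ring.
apply: (@le_trans _ _ (d * C * `|h|)); last by rewrite ler_wpM2r.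
have -> : d * C * `|h| = d * K * (`|h| + 2 * (K1 + 1) * `|h|).
  by rewrite /C; ring.
by rewrite ler_wpM2l ?lerD2l // mulr_ge0 // ltW.
Unshelve. all: by end_near. Qed.

End ParameterChange.

Section MeanCurvatureTrace.
Context {R : realType}.

Lemma mulmx0_unitmx k (A : 'M[R]_k) :
  (forall v : 'rV[R]_k, v *m A = 0 -> v = 0) -> A \in unitmx.
Proof.
move=> A0; rewrite -row_free_unit -kermx_eq0; apply/rowV0P => v /sub_kermxP.
exact: A0.
Qed.

(** A kernel vector [v] makes [v *m J] null for [G], hence zero. Serves for first fundamental forms,
    for Euclidean Gram matrices ([G] the identity) and for the metric itself ([J] the identity). *)
Lemma posdef_gram_unit k m (G : 'M[R]_m) (J : 'M[R]_(k, m)) :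
  posdef G -> row_free J -> J *m G *m J^T \in unitmx.
Proof.
move=> [_ G0] /row_freeP[P JP]; apply: mulmx0_unitmx => v v0.
have [vJ|/G0] := eqVneq (v *m J) 0.
  by rewrite -[v]mulmx1 -JP mulmxA vJ mul0mx.
have -> : v *m J *m G *m (v *m J)^T = v *m (J *m G *m J^T) *m v^T.
  by rewrite trmx_mul !mulmxA.
by rewrite v0 mul0mx mxE ltxx.
Qed.

(** Turns nondegeneracy of a first form into the rank condition of an immersion; this is how the
    cone parametrization is seen to be immersed. *)
Lemma mulmx_unit_row_free k m (J : 'M[R]_(k, m)) (B : 'M[R]_(m, k)) :
  J *m B \in unitmx -> row_free J.
Proof.
move=> U; apply/row_freeP; exists (B *m invmx (J *m B)).
by rewrite mulmxA mulmxV.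
Qed.

Lemma mulmx_trmxE k l m p (J : 'M[R]_(k, m)) (G : 'M[R]_(m, p)) (K : 'M[R]_(l, p)) a b :
  (J *m G *m K^T) a b = \sum_j \sum_l G j l * J a j * K b l.
Proof.
rewrite exchange_big mxE; apply: eq_bigr => q _; rewrite !mxE mulr_suml.
by apply: eq_bigr => j _; rewrite [_ * G j q]mulrC.
Qed.

(** The trace is invariant under the congruence by [A]. The inhomogeneous terms contribute a
    combination of the [x c] whose coefficients depend only on [D]; with [x c] the components of the
    c-th tangent vector and [D c] a Hessian of the parameter change, this is a tangent vector. *)
Lemma trace_change k (A h C : 'M[R]_k) (x : 'I_k -> R) (D : 'I_k -> 'M[R]_k) :
  A \in unitmx -> h \in unitmx ->
  \tr (invmx (A *m h *m A^T) *m (A *m C *m A^T + \sum_c x c *: D c)^T) =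
  \tr (invmx h *m C^T) +
  \sum_c \tr (invmx (A *m h *m A^T) *m (D c)^T) * x c.
Proof.
move=> UA Uh; have UAT : A^T \in unitmx by rewrite unitmx_tr.
have trD (X Y : 'M[R]_k) : (X + Y)^T = X^T + Y^T.
  by apply/matrixP => a b; rewrite !mxE.
rewrite trD mulmxDr mxtraceD; congr (_ + _).
  have -> : invmx (A *m h *m A^T) = invmx A^T *m (invmx h *m invmx A).
    have UB : A *m h *m A^T \in unitmx by rewrite !unitmx_mul UA Uh UAT.
    by rewrite -[RHS](mulKmx UB) !mulmxA mulmxK // mulmxK // mulmxK.
  rewrite !trmx_mul trmxK !mulmxA mxtrace_mulC !mulmxA mulmxV //.
  by rewrite mul1mx mulmxKV.
rewrite linear_sum mulmx_sumr linear_sum; apply: eq_bigr => c _.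
by rewrite linearZ /= -scalemxAr linearZ /= mulrC.
Qed.

Section At.
Context {k m : nat}.
Variables (g : 'rV[R]_m -> 'M[R]_m) (F : 'rV[R]_k -> 'rV[R]_m) (u : 'rV[R]_k).

Definition cov_trace : 'rV[R]_m := \sum_(a < k) \sum_(b < k)
  invmx (first_form g F u) a b *: cov_deriv g F a b u.

Lemma mean_curvatureE : mean_curvature g F u = normal_part g F u cov_trace.
Proof.
rewrite /normal_part /cov_trace !mulmx_suml -sumrB; apply: eq_bigr => a _.
rewrite !mulmx_suml -sumrB; apply: eq_bigr => b _.
by rewrite /second_form /normal_part scalerBr -!scalemxAl.
Qed.

Lemma normal_part_eq0 v : first_form g F u \in unitmx ->
  normal_part g F u v = 0 <-> exists w, v = w *m 'J F u.
Proof.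
rewrite /normal_part => U; split=> [/eqP|[w ->]].
  by rewrite subr_eq0 => /eqP {1}->; eexists.
set h := first_form g F u in U *.
have -> : w *m 'J F u *m g (F u) *m ('J F u)^T *m invmx h *m 'J F u =
    w *m (h *m invmx h) *m 'J F u by rewrite /h /first_form !mulmxA.
by rewrite mulmxV // mulmx1 subrr.
Qed.

(* The normal projection kills exactly the tangent vectors, so that vanishing of the
   mean curvature is tangency of the unprojected trace. *)
Lemma mean_curvature_eq0 : first_form g F u \in unitmx ->
  mean_curvature g F u = 0 <-> exists w, cov_trace = w *m 'J F u.
Proof. by rewrite mean_curvatureE; exact: normal_part_eq0. Qed.

(** One matrix in the parameter indices per target component, so that a change of parameters acts by
    congruence. *)
Definition hess (i : 'I_m) : 'M[R]_k :=
  \matrix_(a, b) partial a (partial b (fun w => F w 0 i)) u.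

Definition covmx (i : 'I_m) : 'M[R]_k := \matrix_(a, b) cov_deriv g F a b u 0 i.

Lemma covmxE i : covmx i = hess i +
  'J F u *m (\matrix_(j, l) christoffel g i j l (F u)) *m ('J F u)^T.
Proof.
apply/matrixP => a b; rewrite [RHS]mxE mulmx_trmxE ![X in X = _]mxE [X in _ = X + _]mxE.
congr (_ + _); apply: eq_bigr => j _; apply: eq_bigr => l _.
by rewrite [X in _ = X * _ * _]mxE.
Qed.

Lemma cov_traceE i :
  cov_trace 0 i = \tr (invmx (first_form g F u) *m (covmx i)^T).
Proof.
rewrite /cov_trace /mxtrace summxE; apply: eq_bigr => a _.
by rewrite summxE mxE; apply: eq_bigr => b _; rewrite !mxE.
Qed.

End At.

Section ParameterInvariance.
Context {k m : nat}.
Implicit Types (f : 'rV[R]_k -> 'rV[R]_m) (phi : 'rV[R]_k -> 'rV[R]_k).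

Lemma partial_comp p (phi : 'rV[R]_p -> 'rV[R]_k) (h : 'rV[R]_k -> R) a u :
  differentiable phi u -> differentiable h (phi u) ->
  partial a (h \o phi) u = \sum_c 'J phi u a c * partial c h (phi u).
Proof.
move=> dphi dh; rewrite /partial deriveE; last exact: differentiable_comp.
rewrite diff_comp //= -row_jacobian [row a _]row_sum_delta linear_sum.
by apply: eq_bigr => c _; rewrite linearZ /= mxE deriveE.
Qed.

Lemma jacobian_comp f phi u :
  differentiable phi u -> differentiable f (phi u) ->
  'J (f \o phi) u = 'J phi u *m 'J f (phi u).
Proof.
move=> dphi df; apply/matrixP => a j; rewrite jacobianE; last exact: differentiable_comp.
rewrite mxE (partial_comp (h := fun w => f w 0 j)) //.
  by apply: eq_bigr => c _; rewrite (jacobianE c j df).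
by move/differentiable_mxP : df.
Qed.

Lemma hess_comp f phi u : {near u, forall u, differentiable phi u} ->
  {near phi u, forall v, differentiable f v} ->
  (forall b c, differentiable (partial b (fun w => phi w 0 c)) u) ->
  (forall c i, differentiable (partial c (fun w => f w 0 i)) (phi u)) ->
  forall i, hess (f \o phi) u i =
    'J phi u *m hess f (phi u) i *m ('J phi u)^T +
    \sum_c 'J f (phi u) c i *: hess phi u c.
Proof.
move=> dphi df ddphi ddf i; apply/matrixP => a b.
have dphi0 := nbhs_singleton dphi.
rewrite mxE.
(* The first-order chain rule holds on a whole neighbourhood, hence may be substituted under the
   outer derivative. *)
have -> : partial a (partial b (fun w => (f \o phi) w 0 i)) u = partial a
    (fun y => \sum_c partial b (fun w => phi w 0 c) y *
                     partial c (fun w => f w 0 i) (phi y)) u.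
  apply: near_eq_partial.
  have dfphi := differentiable_continuous dphi0 df.
  near=> y.
  have dphiy : differentiable phi y by near: y.
  have dfy : differentiable f (phi y) by near: y.
  rewrite (partial_comp (h := fun w => f w 0 i)) //.
    by apply: eq_bigr => c _; rewrite (jacobianE b c dphiy).
  by move/differentiable_mxP : dfy.
have D c : is_derive u (delta_mx 0 a) (fun y => partial b (fun w => phi w 0 c) y *
                     partial c (fun w => f w 0 i) (phi y))
  (partial b (fun w => phi w 0 c) u * (\sum_d 'J phi u a d *
       partial d (partial c (fun w => f w 0 i)) (phi u)) +
   partial c (fun w => f w 0 i) (phi u) * hess phi u c a b).
  rewrite -(partial_comp a (h := partial c (fun w => f w 0 i)) dphi0 (ddf c i)).
  rewrite mxE; apply: is_deriveM.
    by split=> //; exact: diff_derivable.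
  by split=> //; apply: diff_derivable; exact: differentiable_comp.
have [_] := is_derive_sum D.
rewrite (_ : \sum_c _ = fun y => \sum_c partial b (fun w => phi w 0 c) y *
    partial c (fun w => f w 0 i) (phi y)); last first.
  by apply/funext => y; rewrite fct_sumE.
rewrite /partial => ->; rewrite big_split [RHS]mxE mulmx_trmxE summxE /=.
congr (_ + _); last first.
  by apply: eq_bigr => c _; rewrite [RHS]mxE (jacobianE c i (nbhs_singleton df)).
rewrite exchange_big; apply: eq_bigr => c _; rewrite mulr_sumr.
apply: eq_bigr => d _.
by rewrite [hess _ _ _ _ _]mxE (jacobianE b c dphi0) /partial mulrC [_ * 'J phi u a d]mulrC.
Unshelve. all: by end_near. Qed.

Lemma near_eq_hess f f' u i : (\near u, f u = f' u) -> hess f u i = hess f' u i.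
Proof.
move=> ff'; apply/matrixP => a b; rewrite [LHS]mxE [RHS]mxE; apply: near_eq_partial.
apply: filterS (near_eq_near ff') => y yE; apply: near_eq_partial.
by apply: filterS yE => w ->.
Qed.

(** The unprojected traces differ by a tangent vector and the tangent spaces coincide, so tangency
    passes from one parametrization to the other. *)
Lemma mean_curvature_comp (g : 'rV[R]_m -> 'M[R]_m) f1 f2 phi u :
  (\near u, f2 (phi u) = f1 u) ->
  {near u, forall u, differentiable phi u} ->
  {near phi u, forall v, differentiable f2 v} ->
  (forall b c, differentiable (partial b (fun w => phi w 0 c)) u) ->
  (forall c i, differentiable (partial c (fun w => f2 w 0 i)) (phi u)) ->
  'J phi u \in unitmx -> first_form g f2 (phi u) \in unitmx ->
  first_form g f1 u \in unitmx /\
  (mean_curvature g f2 (phi u) = 0 -> mean_curvature g f1 u = 0).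
Proof.
move=> f12 dphi df2 ddphi ddf2 UA U2.
have dphi0 := nbhs_singleton dphi; have df20 := nbhs_singleton df2.
have f12u : f1 u = f2 (phi u) by apply/esym; exact: (nbhs_singleton f12).
have J1 : 'J f1 u = 'J phi u *m 'J f2 (phi u).
  apply: etrans (jacobian_comp dphi0 df20); apply/esym.
  apply: (@near_eq_jacobian _ _ _ (f2 \o phi) f1 _ _ f12).
  exact: differentiable_comp.
have H1 i : hess f1 u i = 'J phi u *m hess f2 (phi u) i *m ('J phi u)^T +
    \sum_c 'J f2 (phi u) c i *: hess phi u c.
  apply: etrans (hess_comp dphi df2 ddphi ddf2 i); apply/esym.
  exact: (near_eq_hess (f := f2 \o phi) i f12).
have h1 : first_form g f1 u =
    'J phi u *m first_form g f2 (phi u) *m ('J phi u)^T.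
  by rewrite /first_form J1 f12u trmx_mul !mulmxA.
have U1 : first_form g f1 u \in unitmx.
  by rewrite h1 !unitmx_mul unitmx_tr UA U2.
(* The Christoffel term is quadratic in the Jacobian and taken at the same target point, so it
   transforms by pure congruence; only the Hessian adds a term. *)
have C1 i : covmx g f1 u i = 'J phi u *m covmx g f2 (phi u) i *m ('J phi u)^T +
    \sum_c 'J f2 (phi u) c i *: hess phi u c.
  rewrite !covmxE H1 J1 f12u trmx_mul mulmxDr mulmxDl !mulmxA.
  by rewrite addrAC.
split; first exact: U1.
move=> /(mean_curvature_eq0 U2)[w wE]; apply/(mean_curvature_eq0 U1).
have UAT : ('J phi u)^T \in unitmx by rewrite unitmx_tr.
(* The tangential discrepancy of the two traces, in the basis of rows of ['J f2 (phi u)]: the metric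
   trace of the second derivatives of [phi]. *)
pose d := \row_c \tr (invmx (first_form g f1 u) *m (hess phi u c)^T).
suff E : cov_trace g f1 u = cov_trace g f2 (phi u) + d *m 'J f2 (phi u).
  exists ((w + d) *m invmx ('J phi u)).
  by rewrite E wE J1 mulmxA mulmxKV // mulmxDl.
apply/rowP => i; rewrite [RHS]mxE [LHS]cov_traceE [in RHS]cov_traceE.
rewrite C1 h1 trace_change //; congr (_ + _); rewrite mxE; apply: eq_bigr => c _.
by rewrite [X in _ = X * _]mxE h1.
Qed.

End ParameterInvariance.
End MeanCurvatureTrace.

(** * Covariant derivatives tested against vectors *)

Section LoweredCovariantDerivative.
Context {R : realType} {m k : nat}.
Variables (g : 'rV[R]_m -> 'M[R]_m) (F : 'rV[R]_k -> 'rV[R]_m).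

Lemma derive_sum_delta (W : normedModType R) (h : 'rV[R]_m -> W) x v :
  differentiable h x -> 'D_v h x = \sum_j v 0 j *: 'D_(delta_mx 0 j) h x.
Proof.
move=> dh; rewrite deriveE // {1}[v]row_sum_delta linear_sum.
by apply: eq_bigr => j _; rewrite linearZ /= deriveE.
Qed.

(* Koszul formula, against an arbitrary test vector: no inverse metric occurs. *)
Lemma cov_deriv_lower a b u (y : 'rV[R]_m) :
  (g (F u))^T = g (F u) -> g (F u) \in unitmx -> differentiable g (F u) ->
  let A := row a ('J F u) in let B := row b ('J F u) in
  (cov_deriv g F a b u *m g (F u) *m y^T) 0 0 =
  ((\row_i hess F u i a b) *m g (F u) *m y^T) 0 0 +
  2^-1 * ((B *m 'D_A g (F u) *m y^T) 0 0 + (A *m 'D_B g (F u) *m y^T) 0 0 -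
          (A *m 'D_y g (F u) *m B^T) 0 0).
Proof.
move=> gT gU dg A B; set x := F u in gT gU dg *.
have [dG dGE] : exists dG : 'I_m -> 'M[R]_m, forall j, 'D_(delta_mx 0 j) g x = dG j.
  by exists (fun j => 'D_(delta_mx 0 j) g x).
have [D DD] : exists D : 'rV[R]_m -> 'M[R]_m, forall v, 'D_v g x = D v.
  by exists (fun v => 'D_v g x).
have DE v l p : D v l p = \sum_j v 0 j * dG j l p.
  rewrite -DD derive_sum_delta // summxE; apply: eq_bigr => j _.
  by rewrite mxE dGE.
(* Twice the Christoffel symbols of the first kind, contracted with the two tangent vectors; raising
   the index is postponed until the pairing with [g] cancels it. *)
pose K : 'rV[R]_m := \row_p \sum_j \sum_l
  (dG j l p + dG l j p - dG p j l) * A 0 j * B 0 l.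
have partialE j l p : partial j (fun z => g z l p) x = dG j l p.
  by rewrite -dGE derive_mx ?mxE //; exact: diff_derivable.
have invT i p : invmx (g x) i p = invmx (g x) p i.
  by rewrite -[in LHS]gT -trmx_inv mxE.
have covE : cov_deriv g F a b u =
    \row_i hess F u i a b + 2^-1 *: (K *m invmx (g x)).
  apply/rowP => i; rewrite [LHS]mxE [RHS]mxE [X in _ = X + _]mxE.
  rewrite [X in _ = X + _]mxE [X in _ = _ + X]mxE; congr (_ + _).
  rewrite [X in _ = _ * X]mxE mulr_sumr.
  under [RHS]eq_bigr => p _.
    rewrite [K _ _]mxE mulr_suml mulr_sumr.
    under eq_bigr => j _ do rewrite mulr_suml mulr_sumr.
    over.
  rewrite [RHS]exchange_big; apply: eq_bigr => j _.
  rewrite [RHS]exchange_big; apply: eq_bigr => l _ /=.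
  rewrite /christoffel -/x mulr_sumr !mulr_suml; apply: eq_bigr => p _.
  rewrite !partialE [A 0 j]mxE [B 0 l]mxE invT; ring.
rewrite (DD A) (DD B) (DD y).
rewrite covE !mulmxDl [LHS]mxE -!scalemxAl mulmxKV //; congr (_ + _).
rewrite [LHS]mxE; congr (_ * _); rewrite !mulmx_trmxE mxE.
under eq_bigr => p _ do rewrite [K _ _]mxE mulr_suml.
rewrite exchange_big /=.
(* The three Koszul terms are brought to one summation pattern, [j] on [A], [p] on [y] and [l] on
   [B], to be compared summand by summand. *)
have E1 : \sum_j \sum_l D A j l * B 0 j * y 0 l =
    \sum_j \sum_p \sum_l dG j l p * A 0 j * B 0 l * y 0 p.
  rewrite [RHS]exchange_big /= [LHS]exchange_big /=; apply: eq_bigr => p _.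
  rewrite [RHS]exchange_big /=; apply: eq_bigr => l _.
  by rewrite DE !mulr_suml; apply: eq_bigr => j _; ring.
have E2 : \sum_j \sum_l D B j l * A 0 j * y 0 l =
    \sum_j \sum_p \sum_l dG l j p * A 0 j * B 0 l * y 0 p.
  apply: eq_bigr => j _; apply: eq_bigr => p _.
  by rewrite DE !mulr_suml; apply: eq_bigr => l _; ring.
have E3 : \sum_j \sum_l D y j l * A 0 j * B 0 l =
    \sum_j \sum_p \sum_l dG p j l * A 0 j * B 0 l * y 0 p.
  apply: eq_bigr => j _; rewrite [RHS]exchange_big /=; apply: eq_bigr => l _.
  by rewrite DE !mulr_suml; apply: eq_bigr => p _; ring.
rewrite E1 E2 E3 -big_split -sumrB /=; apply: eq_bigr => j _.
rewrite -big_split -sumrB /=; apply: eq_bigr => p _.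
rewrite -big_split -sumrB /= mulr_suml [y^T _ _]mxE; apply: eq_bigr => l _.
by ring.
Qed.

End LoweredCovariantDerivative.

(** * Derivatives of the two metrics *)

Section DeriveCalculus.
Context {R : realType} {V : normedModType R}.

Lemma is_derive_block_mx m1 m2 n1 n2 (A : V -> 'M[R]_(m1, n1))
    (B : V -> 'M[R]_(m1, n2)) (C : V -> 'M[R]_(m2, n1)) (D : V -> 'M[R]_(m2, n2))
    dA dB dC dD x v :
  is_derive x v A dA -> is_derive x v B dB ->
  is_derive x v C dC -> is_derive x v D dD ->
  is_derive x v (fun y => block_mx (A y) (B y) (C y) (D y)) (block_mx dA dB dC dD).
Proof.
move=> hA hB hC hD; apply: is_derive_mx => i j.
case: (split_ordP i) => i' ->; case: (split_ordP j) => j' ->.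
- under eq_fun do rewrite block_mxEul.
  by rewrite block_mxEul; exact: is_derive_coord.
- under eq_fun do rewrite block_mxEur.
  by rewrite block_mxEur; exact: is_derive_coord.
- under eq_fun do rewrite block_mxEdl.
  by rewrite block_mxEdl; exact: is_derive_coord.
- under eq_fun do rewrite block_mxEdr.
  by rewrite block_mxEdr; exact: is_derive_coord.
Qed.

Lemma is_derive_row_mx m n1 n2 (A : V -> 'M[R]_(m, n1)) (B : V -> 'M[R]_(m, n2))
    dA dB x v : is_derive x v A dA -> is_derive x v B dB ->
  is_derive x v (fun y => row_mx (A y) (B y)) (row_mx dA dB).
Proof.
move=> hA hB; apply: is_derive_mx => i j.
case: (split_ordP j) => j' ->.
- under eq_fun do rewrite row_mxEl.
  by rewrite row_mxEl; exact: is_derive_coord.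
- under eq_fun do rewrite row_mxEr.
  by rewrite row_mxEr; exact: is_derive_coord.
Qed.

Lemma is_derive_col_mx m1 m2 n (A : V -> 'M[R]_(m1, n)) (B : V -> 'M[R]_(m2, n))
    dA dB x v : is_derive x v A dA -> is_derive x v B dB ->
  is_derive x v (fun y => col_mx (A y) (B y)) (col_mx dA dB).
Proof.
move=> hA hB; apply: is_derive_mx => i j.
case: (split_ordP i) => i' ->.
- under eq_fun do rewrite col_mxEu.
  by rewrite col_mxEu; exact: is_derive_coord.
- under eq_fun do rewrite col_mxEd.
  by rewrite col_mxEd; exact: is_derive_coord.
Qed.

Lemma is_derive_ext (W : normedModType R) (f g : V -> W) x v D D' :
  is_derive x v f D -> f =1 g -> D = D' -> is_derive x v g D'.
Proof. by move=> h /funext <- <-. Qed.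

Lemma is_derive_scalar_mx n (c : V -> R) dc x v : is_derive x v c dc ->
  is_derive x v (fun y => (c y)%:M : 'M[R]_n) (dc%:M).
Proof.
move=> hc; apply: is_derive_mx => i j.
under eq_fun do rewrite mxE.
rewrite mxE; case: (i == j) => //=.
by rewrite mulr0n; exact: is_derive_cst.
Qed.

Lemma is_derive_scalemx m n (c : V -> R) (A : V -> 'M[R]_(m, n)) dc dA x v :
  is_derive x v c dc -> is_derive x v A dA ->
  is_derive x v (fun y => c y *: A y) (c x *: dA + dc *: A x).
Proof.
move=> hc hA; apply: is_derive_mx => i j.
under eq_fun do rewrite mxE.
rewrite [X in is_derive _ _ _ X]mxE [X in X + _]mxE [X in _ + X]mxE [dc * _]mulrC.
exact: (is_deriveM hc (is_derive_coord i j hA)).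
Qed.

Lemma is_derive_diff_comp (W U : normedModType R) (f : V -> W) (h : W -> U) w x v :
  differentiable f x -> differentiable h (f x) -> is_derive x v f w ->
  is_derive x v (h \o f) ('D_w h (f x)).
Proof.
move=> df dh [_ <-]; rewrite deriveE // deriveE //.
have := diff_is_derive v (differentiable_comp df dh).
by rewrite diff_comp.
Qed.

Lemma differentiable_row_mx m n1 n2 (A : V -> 'M[R]_(m, n1)) (B : V -> 'M[R]_(m, n2)) x :
  differentiable A x -> differentiable B x ->
  differentiable (fun y => row_mx (A y) (B y)) x.
Proof.
move=> /differentiable_mxP dA /differentiable_mxP dB.
apply/differentiable_mxP => i j; case: (split_ordP j) => j' ->.
- by under eq_fun do rewrite row_mxEl.
- by under eq_fun do rewrite row_mxEr.
Qed.

Lemma differentiable_scalar_mx n (c : V -> R) x : differentiable c x ->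
  differentiable (fun y => (c y)%:M : 'M[R]_n) x.
Proof.
move=> dc; apply/differentiable_mxP => i j.
under eq_fun do rewrite mxE.
by case: (i == j); [exact: dc | exact: differentiable_cst].
Qed.

End DeriveCalculus.

Section DeriveProjections.
Context {R : realType} {m n1 n2 : nat}.
Implicit Types z v : 'M[R]_(m, n1 + n2).

Lemma is_derive_lsubmx z v : is_derive z v (@lsubmx R m n1 n2) (lsubmx v).
Proof.
have := diff_is_derive v (@differentiable_lsubmx R m n1 n2 z).
by rewrite diff_lin //; exact: continuous_lsubmx.
Qed.

Lemma is_derive_rsubmx z v : is_derive z v (@rsubmx R m n1 n2) (rsubmx v).
Proof.
have := diff_is_derive v (@differentiable_rsubmx R m n1 n2 z).
by rewrite diff_lin //; exact: continuous_rsubmx.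
Qed.

End DeriveProjections.

Section MetricDerivatives.
Context {R : realType} {n : nat} {M : manifold R n}.
Implicit Types (gam : R -> components R (mindex M) n) (i : mindex M).

(** Jointly in the point of [M] and the family parameter: differentiating a metric needs the chain
    rule in both at once. *)
Definition family_at gam i (w : 'rV[R]_(n + 1)) : 'M[R]_n :=
  gam (rsubmx w 0 0) i (lsubmx w).

Lemma is_derive_inv (V : normedModType R) (f : V -> R) x v df : f x != 0 ->
  is_derive x v f df -> is_derive x v (fun y => (f y)^-1) (- (f x) ^- 2 * df).
Proof.
by move=> f0 [dv <-]; split; [exact: derivableV | rewrite deriveV].
Qed.

Lemma is_derive_sqr (V : normedModType R) (f : V -> R) x v df :
  is_derive x v f df -> is_derive x v (fun y => f y ^+ 2) (2 * f x * df).
Proof.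
move=> hf.
have -> : 2 * f x * df = f x *: df + f x *: df by rewrite -scalerDl; congr (_ * _); ring.
exact: (is_deriveM hf hf).
Qed.

Lemma differentiable_sqr (V : normedModType R) (f : V -> R) x :
  differentiable f x -> differentiable (fun y => f y ^+ 2) x.
Proof. by move=> df; exact: (differentiableM df df). Qed.

Lemma block_diag_lincomb (A B : 'M[R]_n) (c d : R) :
  c *: block_mx A 0 0 0 + d *: block_mx B 0 0 1%:M =
  block_mx (c *: A + d *: B) 0 0 d%:M :> 'M[R]_(n + 1).
Proof.
rewrite !scale_block_mx add_block_mx !scaler0 !addr0 add0r.
by rewrite scale_scalar_mx mulr1.
Qed.

Lemma is_derive_last (z v : 'rV[R]_(n + 1)) :
  is_derive z v (fun y => rsubmx y 0 0) (rsubmx v 0 0).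
Proof. exact: (is_derive_coord 0 0 (is_derive_rsubmx z v)). Qed.

Lemma differentiable_last (z : 'rV[R]_(n + 1)) :
  differentiable (fun y : 'rV[R]_(n + 1) => rsubmx y 0 0) z.
Proof.
by have /differentiable_mxP := @differentiable_rsubmx R 1 n 1 z.
Qed.

Lemma is_derive_ambient gam i (z v : 'rV[R]_(1 + n + 1)) :
  let t := lsubmx (lsubmx z) 0 0 in let tau := lsubmx (lsubmx v) 0 0 in
  let w := row_mx (rsubmx (lsubmx z)) (rsubmx z) in
  let dw := row_mx (rsubmx (lsubmx v)) (rsubmx v) in
  differentiable (family_at gam i) w ->
  is_derive z v (ambient_metric gam i)
    (block_mx (block_mx (2 * rsubmx v 0 0)%:M 0 0
        (t ^+ 2 *: 'D_dw (family_at gam i) w + (2 * t * tau) *: family_at gam i w))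
      (col_mx tau%:M 0) (row_mx tau%:M 0) 0).
Proof.
move=> t tau w dw dG.
have ht : is_derive z v (fun y => lsubmx (lsubmx y) 0 0) tau.
  rewrite /tau !mxE; under eq_fun do rewrite !mxE.
  exact: (is_derive_coord _ _ (is_derive_id z v)).
have hw : is_derive z v (fun y => row_mx (rsubmx (lsubmx y)) (rsubmx y) : 'rV[R]_(n + 1)) dw.
  apply: is_derive_row_mx; last exact: is_derive_rsubmx.
  apply: is_derive_mx => a b; rewrite !mxE; under eq_fun do rewrite !mxE.
  exact: (is_derive_coord _ _ (is_derive_id z v)).
have dw' : differentiable (fun y => row_mx (rsubmx (lsubmx y)) (rsubmx y) : 'rV[R]_(n + 1)) z.
  apply: differentiable_row_mx; last exact: differentiable_rsubmx.
  apply: (@differentiable_comp _ _ _ _ (@lsubmx R 1 (1 + n) 1)).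
    exact: differentiable_lsubmx.
  exact: differentiable_rsubmx.
apply: is_derive_block_mx.
- apply: is_derive_block_mx.
    apply: is_derive_scalar_mx.
    exact: (is_deriveZ 2 (is_derive_coord 0 0 (is_derive_rsubmx z v))).
  have hG := is_derive_diff_comp dw' dG hw.
  have := is_derive_scalemx (is_derive_sqr ht) hG.
  rewrite (_ : (fun y => _ *: (_ \o _) y) = fun y => lsubmx (lsubmx y) 0 0 ^+ 2 *:
    gam (rsubmx y 0 0) i (rsubmx (lsubmx y))) //.
  by apply/funext => y; rewrite /= /family_at row_mxKl row_mxKr.
- by apply: is_derive_col_mx; exact: is_derive_scalar_mx.
- by apply: is_derive_row_mx; exact: is_derive_scalar_mx.
Qed.

(** Near [z] the metric factors through rho = - r^2 / 2, whose derivative [- (r * sigma)] is the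
    last entry of [dw]; [- 2 * sigma / r ^+ 3] is the derivative of the conformal factor r^-2. *)
Lemma is_derive_poincare gr grho i (z v : 'rV[R]_(n + 1)) :
  let r := rsubmx z 0 0 in let sigma := rsubmx v 0 0 in
  let w := row_mx (lsubmx z) (- (r ^+ 2 / 2))%:M in
  let dw := row_mx (lsubmx v) (- (r * sigma))%:M in
  r != 0 ->
  (\forall y \near z, gr (rsubmx y 0 0) i (lsubmx y) =
                     grho (- (rsubmx y 0 0 ^+ 2 / 2)) i (lsubmx y)) ->
  differentiable (family_at grho i) w ->
  is_derive z v (poincare_metric gr i)
    (block_mx (r ^- 2 *: 'D_dw (family_at grho i) w
               - (2 * sigma / r ^+ 3) *: family_at grho i w) 0 0
              (- (2 * sigma / r ^+ 3))%:M).
Proof.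
move=> r sigma w dw r0 grE dG.
have hr := is_derive_last z v; rewrite -/sigma in hr.
have hV := is_derive_inv (f := fun y : 'rV[R]_(n + 1) => rsubmx y 0 0 ^+ 2) (x := z)
  (expf_neq0 2 r0) (is_derive_sqr hr).
rewrite -/r in hV.
pose phi (y : 'rV[R]_(n + 1)) : 'rV[R]_(n + 1) :=
  row_mx (lsubmx y) (- (rsubmx y 0 0 ^+ 2 / 2))%:M.
have hphi : is_derive z v phi dw.
  apply: is_derive_row_mx; first exact: is_derive_lsubmx.
  apply: is_derive_scalar_mx.
  have := is_deriveZ (- 2^-1) (is_derive_sqr hr).
  have -> : - 2^-1 *: (2 * rsubmx z 0 0 * sigma) = - (r * sigma).
    by rewrite /GRing.scale /= -/r; field.
  suff -> : (fun y : 'rV[R]_(n + 1) => - (rsubmx y 0 0 ^+ 2 / 2)) =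
    (- 2^-1) \*: (fun y : 'rV[R]_(n + 1) => rsubmx y 0 0 ^+ 2) by [].
  by apply/funext => y; rewrite mulrC -mulNr.
have dphi : differentiable phi z.
  apply: differentiable_row_mx; first exact: differentiable_lsubmx.
  apply: differentiable_scalar_mx.
  have := differentiableZ (- 2^-1) (differentiable_sqr (differentiable_last z)).
  suff -> : (fun y : 'rV[R]_(n + 1) => - (rsubmx y 0 0 ^+ 2 / 2)) =
    (- 2^-1) \*: (fun y : 'rV[R]_(n + 1) => rsubmx y 0 0 ^+ 2) by [].
  by apply/funext => y; rewrite mulrC -mulNr.
have hG := is_derive_diff_comp dphi dG hphi.
have hB : is_derive z v (fun y => block_mx ((family_at grho i \o phi) y) 0 0 1%:M)
   (block_mx ('D_dw (family_at grho i) w) 0 0 0 : 'M[R]_(n + 1)).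
  by apply: is_derive_block_mx.
have := is_derive_scalemx hV hB.
rewrite block_diag_lincomb.
have -> : - r ^+ 2 ^- 2 * (2 * r * sigma) = - (2 * sigma / r ^+ 3) by field.
rewrite [(_ \o phi) z]/= -[phi z]/w scaleNr.
apply: near_eq_is_derive; apply: filterS grE => y yE.
by rewrite /poincare_metric yE /family_at /phi /= row_mxKl row_mxKr [_%:M 0 0]mxE.
Qed.

End MetricDerivatives.

Section Forms.
Context {R : realType}.

Definition gform m (G : 'M[R]_m) (v w : 'rV[R]_m) : R := (v *m G *m w^T) 0 0.

Lemma gformD m (G H : 'M[R]_m) v w : gform (G + H) v w = gform G v w + gform H v w.
Proof. by rewrite /gform mulmxDr mulmxDl mxE. Qed.

Lemma gformZ m c (G : 'M[R]_m) v w : gform (c *: G) v w = c * gform G v w.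
Proof. by rewrite /gform -scalemxAr -scalemxAl mxE. Qed.

Lemma gformN m (G : 'M[R]_m) v w : gform (- G) v w = - gform G v w.
Proof. by rewrite -scaleN1r gformZ mulN1r. Qed.

Lemma gform0l m (G : 'M[R]_m) w : gform G 0 w = 0.
Proof. by rewrite /gform !mul0mx mxE. Qed.

Lemma gform0r m (G : 'M[R]_m) w : gform G w 0 = 0.
Proof. by rewrite /gform trmx0 mulmx0 mxE. Qed.

Lemma gform_scalar (c : R) (v w : 'rV[R]_1) : gform c%:M v w = c * v 0 0 * w 0 0.
Proof. by rewrite /gform mul_mx_scalar -scalemxAl !mxE big_ord1 mxE mulrA. Qed.

Lemma gform_inj m (G : 'M[R]_m) v v' : G \in unitmx ->
  (forall w, gform G v w = gform G v' w) -> v = v'.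
Proof.
move=> GU vv'; apply: (can_inj (mulmxK GU)); apply/rowP => j.
have := vv' (delta_mx 0 j).
by rewrite /gform trmx_delta -!colE !mxE.
Qed.

Lemma gform_unitmx m (G : 'M[R]_m) :
  (forall v, (forall w, gform G v w = 0) -> v = 0) -> G \in unitmx.
Proof.
move=> G0; apply: mulmx0_unitmx => v vG; apply: G0 => w.
by rewrite /gform vG mul0mx mxE.
Qed.

Lemma first_formE k m (g : 'rV[R]_m -> 'M[R]_m) (F : 'rV[R]_k -> 'rV[R]_m) u a b :
  first_form g F u a b = gform (g (F u)) (row a ('J F u)) (row b ('J F u)).
Proof.
rewrite /gform /first_form; move: ('J F u) (g _) => J G; rewrite !mulmx_trmxE.
by apply: eq_bigr => j _; apply: eq_bigr => l _; rewrite !mxE.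
Qed.

Lemma gform_block_diag n (P : 'M[R]_n) c (v w : 'rV[R]_(n + 1)) :
  gform (block_mx P 0 0 c%:M) v w =
  gform P (lsubmx v) (lsubmx w) + c * rsubmx v 0 0 * rsubmx w 0 0.
Proof.
rewrite -gform_scalar -[v in LHS]hsubmxK -[w in LHS]hsubmxK.
rewrite /gform mul_row_block tr_row_mx mul_row_col !mulmx0 addr0 add0r.
by rewrite mxE.
Qed.

Lemma gform_ambient_block n (P : 'M[R]_n) a t (v w : 'rV[R]_(1 + n + 1)) :
  gform (block_mx (block_mx a%:M 0 0 P) (col_mx t%:M 0) (row_mx t%:M 0) 0) v w =
  let vt := lsubmx (lsubmx v) 0 0 in let vr := rsubmx v 0 0 in
  let wt := lsubmx (lsubmx w) 0 0 in let wr := rsubmx w 0 0 in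
  a * vt * wt + t * (vt * wr + vr * wt) +
  gform P (rsubmx (lsubmx v)) (rsubmx (lsubmx w)).
Proof.
rewrite -[v in LHS]hsubmxK -[w in LHS]hsubmxK.
rewrite -[lsubmx v in LHS]hsubmxK -[lsubmx w in LHS]hsubmxK /=.
set vt := lsubmx (lsubmx v); set wt := lsubmx (lsubmx w).
set vx := rsubmx (lsubmx v); set wx := rsubmx (lsubmx w).
set vr := rsubmx v; set wr := rsubmx w.
rewrite /gform mul_row_block mul_row_block mul_mx_row mul_row_col.
rewrite !tr_row_mx mul_row_col add_row_mx mul_row_col !mulmx0 !addr0 !add0r.
rewrite !mul_mx_scalar !mulmxDl -!scalemxAl.
rewrite !mxE !big_ord1 !mxE; ring.
Qed.

End Forms.

(** * The cone over an immersion *)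

Section ConeLift.
Context {R : realType} {n : nat}.

(* The differential of (s, x, r) |-> (s / r, x, - r^2 / 2) at (s, x, r), applied to
   the vector (omega, w). *)
Definition cone_tangent (r s omega : R) (w : 'rV[R]_(n + 1)) : 'rV[R]_(1 + n + 1) :=
  row_mx (row_mx (omega / r - s * rsubmx w 0 0 / r ^+ 2)%:M (lsubmx w))
         (- (r * rsubmx w 0 0))%:M.

(* The derivative of cone_tangent r s omega w along a curve with velocities dr, ds, dw;
   omega is constant. *)
Definition cone_tangent_deriv (r s omega dr ds : R) (w dw : 'rV[R]_(n + 1)) :
    'rV[R]_(1 + n + 1) :=
  row_mx (row_mx (- (omega * dr / r ^+ 2)
                  - (ds * rsubmx w 0 0 + s * rsubmx dw 0 0) / r ^+ 2
                  + 2 * s * rsubmx w 0 0 * dr / r ^+ 3)%:M (lsubmx dw))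
         (- (dr * rsubmx w 0 0 + r * rsubmx dw 0 0))%:M.

Lemma is_derive_cone_tangent (V : normedModType R) (r s : V -> R) omega
    (w : V -> 'rV[R]_(n + 1)) x v dr ds dw :
  r x != 0 -> is_derive x v r dr -> is_derive x v s ds -> is_derive x v w dw ->
  is_derive x v (fun y => cone_tangent (r y) (s y) omega (w y))
    (cone_tangent_deriv (r x) (s x) omega dr ds (w x) dw).
Proof.
move=> r0 hr hs hw.
have he : is_derive x v (fun y => rsubmx (w y) 0 0) (rsubmx dw 0 0).
  rewrite mxE; under eq_fun do rewrite mxE.
  exact: is_derive_coord.
have hV := is_derive_inv r0 hr.
have hV2 := is_derive_inv (f := fun y => r y ^+ 2) (expf_neq0 2 r0) (is_derive_sqr hr).
apply: is_derive_row_mx; last first.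
  apply: is_derive_scalar_mx.
  apply: (is_derive_ext (is_deriveN (is_deriveM hr he))) => [y //|].
  by rewrite /GRing.scale /=; ring.
apply: is_derive_row_mx; last first.
  apply: is_derive_mx => i j; rewrite mxE; under eq_fun do rewrite mxE.
  exact: is_derive_coord.
apply: is_derive_scalar_mx.
apply: (is_derive_ext (is_deriveB (is_deriveZ omega hV) (is_deriveM (is_deriveM hs he) hV2))) => [y //|].
by rewrite /GRing.scale /= !fctE; field.
Qed.

Lemma differentiable_cone (V : normedModType R) (s : V -> R)
    (w : V -> 'rV[R]_(n + 1)) x :
  rsubmx (w x) 0 0 != 0 -> differentiable s x -> differentiable w x ->
  differentiable (fun y => row_mx (row_mx (s y / rsubmx (w y) 0 0)%:M (lsubmx (w y)))
    (- (rsubmx (w y) 0 0 ^+ 2 / 2))%:M : 'rV[R]_(1 + n + 1)) x.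
Proof.
move=> r0 ds dw.
have dr : differentiable (fun y => rsubmx (w y) 0 0) x.
  under eq_fun do rewrite mxE.
  by move/differentiable_mxP : dw.
apply: differentiable_row_mx; last first.
  apply: differentiable_scalar_mx.
  exact: (differentiableN (differentiableM (differentiable_sqr dr)
            (differentiable_cst (2^-1 : R) x))).
apply: differentiable_row_mx; last first.
  apply/differentiable_mxP => i j; under eq_fun do rewrite mxE.
  by move/differentiable_mxP : dw.
apply: differentiable_scalar_mx.
exact: (differentiableM ds (differentiableV dr r0)).
Qed.

Lemma is_derive_cone (V : normedModType R) (s : V -> R)
    (w : V -> 'rV[R]_(n + 1)) x v ds dw :
  rsubmx (w x) 0 0 != 0 -> is_derive x v s ds -> is_derive x v w dw ->
  is_derive x v (fun y => row_mx (row_mx (s y / rsubmx (w y) 0 0)%:M (lsubmx (w y)))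
    (- (rsubmx (w y) 0 0 ^+ 2 / 2))%:M : 'rV[R]_(1 + n + 1))
   (cone_tangent (rsubmx (w x) 0 0) (s x) ds dw).
Proof.
move=> r0 hs hw.
have hr : is_derive x v (fun y => rsubmx (w y) 0 0) (rsubmx dw 0 0).
  rewrite [X in is_derive _ _ _ X]mxE; under eq_fun do rewrite mxE.
  exact: is_derive_coord.
have hV := is_derive_inv (f := fun y => rsubmx (w y) 0 0) r0 hr.
apply: is_derive_row_mx; last first.
  apply: is_derive_scalar_mx.
  apply: (is_derive_ext (is_deriveN (is_deriveM (is_derive_sqr hr) (is_derive_cst (2^-1 : R) x v)))) => [y //|].
  by rewrite /GRing.scale /=; field.
apply: is_derive_row_mx; last first.
  apply: is_derive_mx => i j; rewrite [X in is_derive _ _ _ X]mxE.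
  under eq_fun do rewrite mxE.
  exact: is_derive_coord.
apply: is_derive_scalar_mx.
apply: (is_derive_ext (is_deriveM hs hV)) => [y //|].
by rewrite /GRing.scale /=; field.
Qed.

End ConeLift.

Section DirectionalHessian.
Context {R : realType} {k m : nat}.
Implicit Types F : 'rV[R]_k -> 'rV[R]_m.

Lemma is_derive_row_jacobian F u a D : differentiable F u ->
  is_derive u (delta_mx 0 a) F D -> row a ('J F u) = D.
Proof.
move=> dF hD; apply: etrans (row_jacobian F u a) _.
exact: is_derive_unique (diff_is_derive _ dF) hD.
Qed.

Lemma hess_is_derive F u a b (T : 'rV[R]_k -> 'rV[R]_m) D :
  (\forall y \near u, is_derive y (delta_mx 0 b) F (T y)) ->
  is_derive u (delta_mx 0 a) T D -> \row_i hess F u i a b = D.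
Proof.
move=> hT hD; apply/rowP => i; rewrite [LHS]mxE [LHS]mxE.
have <- : partial a (fun y => T y 0 i) u = D 0 i.
  by have [_] := is_derive_coord 0 i hD.
apply: near_eq_partial; apply: filterS hT => y hy.
by have [_] := is_derive_coord 0 i hy.
Qed.

Lemma differentiable_derive F u b : {near u, forall u, differentiable F u} ->
  (forall i, differentiable (partial b (fun w => F w 0 i)) u) ->
  differentiable (fun y => 'D_(delta_mx 0 b) F y) u.
Proof.
move=> dF ddF; apply/differentiable_mxP => j i; rewrite ord1.
apply: near_eq_differentiable (ddF i).
apply: filterS dF => y dFy; rewrite derive_mx; last exact: diff_derivable.
by rewrite mxE.
Qed.

Lemma hess_derive F u a b : {near u, forall u, differentiable F u} ->
  (forall i, differentiable (partial b (fun w => F w 0 i)) u) ->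
  \row_i hess F u i a b = 'D_(delta_mx 0 a) (fun y => 'D_(delta_mx 0 b) F y) u.
Proof.
move=> dF ddF; apply: (@hess_is_derive _ _ _ _ (fun y => 'D_(delta_mx 0 b) F y)).
  by apply: filterS dF => y dFy; split=> //; exact: diff_derivable.
by split=> //; apply: diff_derivable; exact: differentiable_derive.
Qed.

End DirectionalHessian.

Section ConeLiftDerivatives.
Context {R : realType} {n k : nat}.
Variables (f : 'rV[R]_k -> 'rV[R]_(n + 1)).

(** The first parameter is s = r t rather than t: with this choice the rulings are orthogonal to the
    slices of constant s. *)
Definition cone_lift (z : 'rV[R]_(1 + k)) : 'rV[R]_(1 + n + 1) :=
  let w := f (rsubmx z) in let r := rsubmx w 0 0 in
  row_mx (row_mx (lsubmx z 0 0 / r)%:M (lsubmx w)) (- (r ^+ 2 / 2))%:M.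

Lemma is_derive_rsubmx_comp (W : normedModType R) (h : 'rV[R]_k -> W)
    (z v : 'rV[R]_(1 + k)) : differentiable h (rsubmx z) ->
  is_derive z v (fun y => h (rsubmx y)) ('D_(rsubmx v) h (rsubmx z)).
Proof.
move=> dh; split; last exact: derive_rsubmx.
apply: diff_derivable.
exact: (differentiable_comp (differentiable_rsubmx z) dh).
Qed.

Variable z : 'rV[R]_(1 + k).
Let u := rsubmx z.
Let s := lsubmx z 0 0.
Let r := rsubmx (f u) 0 0.
Hypothesis r0 : r != 0.
Hypothesis df : {near u, forall u, differentiable f u}.

(** The tangent vectors of the lift are differentiated once more, so their formula is required
    around [z] and not only at [z]. *)
Lemma near_lift_regular : \forall y \near z,
  differentiable f (rsubmx y) /\ rsubmx (f (rsubmx y)) 0 0 != 0.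
Proof.
have df0 := nbhs_singleton df.
have cont : (fun w => rsubmx (f w) 0 0) @ u --> r.
  apply: differentiable_continuous; under eq_fun do rewrite mxE.
  by move/differentiable_mxP : df0.
have near_r : \forall w \near u, rsubmx (f w) 0 0 != 0.
  exact: (cvgr_neq0 _ cont r0).
exact: (@continuous_rsubmx R 1 1 k z _ (filterI df near_r)).
Qed.

Lemma differentiable_cone_lift : differentiable cone_lift z.
Proof.
apply: differentiable_cone => //.
  by have /differentiable_mxP := @differentiable_lsubmx R 1 1 k z.
exact: (differentiable_comp (differentiable_rsubmx z) (nbhs_singleton df)).
Qed.

Lemma is_derive_cone_lift v y : differentiable f (rsubmx y) ->
  rsubmx (f (rsubmx y)) 0 0 != 0 ->
  is_derive y v cone_lift (cone_tangent (rsubmx (f (rsubmx y)) 0 0) (lsubmx y 0 0)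
    (lsubmx v 0 0) ('D_(rsubmx v) f (rsubmx y))).
Proof.
move=> dfy ry.
have hs := is_derive_coord 0 0 (is_derive_lsubmx y v).
exact: (is_derive_cone (w := fun y => f (rsubmx y)) ry hs
  (is_derive_rsubmx_comp v dfy)).
Qed.

Lemma lsubmx_delta_lshift : lsubmx (delta_mx 0 (lshift k 0) : 'rV[R]_(1 + k)) = 1%:M.
Proof. by apply/matrixP => i j; rewrite !ord1 !mxE. Qed.

Lemma rsubmx_delta_lshift : rsubmx (delta_mx 0 (lshift k 0) : 'rV[R]_(1 + k)) = 0.
Proof. by apply/matrixP => i j; rewrite !mxE eq_rlshift andbF. Qed.

Lemma lsubmx_delta_rshift a : lsubmx (delta_mx 0 (rshift 1 a) : 'rV[R]_(1 + k)) = 0.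
Proof. by apply/matrixP => i j; rewrite !mxE eq_lrshift andbF. Qed.

Lemma rsubmx_delta_rshift a :
  rsubmx (delta_mx 0 (rshift 1 a) : 'rV[R]_(1 + k)) = delta_mx 0 a.
Proof.
apply/matrixP => i j; by rewrite ord1 !mxE; congr ((_ && _)%:R).
Qed.

Lemma row_jacobian_cone_lift0 :
  row (lshift k 0) ('J cone_lift z) = cone_tangent r s 1 0.
Proof.
have [df0 ry] := nbhs_singleton near_lift_regular.
apply: is_derive_row_jacobian differentiable_cone_lift _.
have := is_derive_cone_lift (delta_mx 0 (lshift k 0)) df0 ry.
by rewrite lsubmx_delta_lshift rsubmx_delta_lshift derive0
  [X in cone_tangent _ _ X _]mxE.
Qed.

Lemma row_jacobian_cone_lift a :
  row (rshift 1 a) ('J cone_lift z) = cone_tangent r s 0 (row a ('J f u)).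
Proof.
have [df0 ry] := nbhs_singleton near_lift_regular.
apply: is_derive_row_jacobian differentiable_cone_lift _.
have := is_derive_cone_lift (delta_mx 0 (rshift 1 a)) df0 ry.
rewrite lsubmx_delta_rshift rsubmx_delta_rshift [X in cone_tangent _ _ X _]mxE.
have -> : row a ('J f u) = 'D_(delta_mx 0 a) f (rsubmx z).
  exact: etrans (row_jacobian f u a) (esym (deriveE _ df0)).
exact.
Qed.

(** Along a ruling only t = s / r moves, and it is linear in s. *)
Lemma hess_cone_lift0 :
  \row_i hess cone_lift z i (lshift k 0) (lshift k 0) = 0.
Proof.
have [df0 ry] := nbhs_singleton near_lift_regular.
pose T (y : 'rV[R]_(1 + k)) := cone_tangent (rsubmx (f (rsubmx y)) 0 0) (lsubmx y 0 0) 1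
  (0 : 'rV[R]_(n + 1)).
apply: (hess_is_derive (T := T)).
  apply: filterS near_lift_regular => y [dfy ryy].
  have := is_derive_cone_lift (delta_mx 0 (lshift k 0)) dfy ryy.
  by rewrite lsubmx_delta_lshift rsubmx_delta_lshift derive0
  [X in cone_tangent _ _ X _]mxE.
have hs := is_derive_coord 0 0 (is_derive_lsubmx z (delta_mx 0 (lshift k 0))).
have dr : differentiable (fun w => rsubmx (f w) 0 0) u.
  by under eq_fun do rewrite mxE; move/differentiable_mxP : df0.
have hr := is_derive_rsubmx_comp (delta_mx 0 (lshift k 0)) dr.
have hw := is_derive_cst (0 : 'rV[R]_(n + 1)) z (delta_mx 0 (lshift k 0)).
have := is_derive_cone_tangent 1 ry hr hs hw.
rewrite rsubmx_delta_lshift derive0 /cone_tangent_deriv linear0 !mxE.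
rewrite !(mulr0, mul0r, addr0, oppr0) raddf0.
rewrite (_ : row_mx _ _ = 0) //.
by rewrite [lsubmx _]linear0 !row_mx0.
Qed.

Hypothesis ddf : forall c j, differentiable (partial c (fun w => f w 0 j)) u.

Lemma hess_cone_lift a b :
  \row_i hess cone_lift z i (rshift 1 a) (rshift 1 b) =
  cone_tangent_deriv r s 0 (rsubmx (row a ('J f u)) 0 0) 0
    (row b ('J f u)) (\row_i hess f u i a b).
Proof.
have [df0 ry] := nbhs_singleton near_lift_regular.
pose T (y : 'rV[R]_(1 + k)) := cone_tangent (rsubmx (f (rsubmx y)) 0 0) (lsubmx y 0 0) 0
  ('D_(delta_mx 0 b) f (rsubmx y)).
apply: (hess_is_derive (T := T)).
  apply: filterS near_lift_regular => y [dfy ryy].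
  have := is_derive_cone_lift (delta_mx 0 (rshift 1 b)) dfy ryy.
  by rewrite lsubmx_delta_rshift rsubmx_delta_rshift
    [X in cone_tangent _ _ X _]mxE.
have hs := is_derive_coord 0 0 (is_derive_lsubmx z (delta_mx 0 (rshift 1 a))).
have dr : differentiable (fun w => rsubmx (f w) 0 0) u.
  by under eq_fun do rewrite mxE; move/differentiable_mxP : df0.
have hr := is_derive_rsubmx_comp (delta_mx 0 (rshift 1 a)) dr.
have hw := is_derive_rsubmx_comp (delta_mx 0 (rshift 1 a))
  (differentiable_derive df (ddf b)).
have := is_derive_cone_tangent 0 ry hr hs hw.
rewrite rsubmx_delta_rshift lsubmx_delta_rshift.
rewrite [X in cone_tangent_deriv _ _ _ _ X]mxE -hess_derive //.
have -> : 'D_(delta_mx 0 a) (fun w => rsubmx (f w) 0 0) (rsubmx z) =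
    rsubmx (row a ('J f u)) 0 0.
  rewrite row_jacobian.
  have h := is_derive_coord 0 (rshift n 0) (diff_is_derive (delta_mx 0 a) df0).
  have [_ <-] : is_derive u (delta_mx 0 a) (fun w => rsubmx (f w) 0 0)
      (rsubmx ('d f u (delta_mx 0 a)) 0 0).
    by rewrite [X in is_derive _ _ _ X]mxE; under eq_fun do rewrite mxE.
  by [].
have -> : row b ('J f u) = 'D_(delta_mx 0 b) f (rsubmx z).
  exact: etrans (row_jacobian f u b) (esym (deriveE _ df0)).
exact.
Qed.

End ConeLiftDerivatives.

Section DifferentiableBlocks.
Context {R : realType} {V : normedModType R}.

Lemma differentiable_block_mx m1 m2 n1 n2 (A : V -> 'M[R]_(m1, n1))
    (B : V -> 'M[R]_(m1, n2)) (C : V -> 'M[R]_(m2, n1)) (D : V -> 'M[R]_(m2, n2)) x :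
  differentiable A x -> differentiable B x ->
  differentiable C x -> differentiable D x ->
  differentiable (fun y => block_mx (A y) (B y) (C y) (D y)) x.
Proof.
move=> /differentiable_mxP dA /differentiable_mxP dB.
move=> /differentiable_mxP dC /differentiable_mxP dD.
apply/differentiable_mxP => i j.
case: (split_ordP i) => i' ->; case: (split_ordP j) => j' ->.
- by under eq_fun do rewrite block_mxEul.
- by under eq_fun do rewrite block_mxEur.
- by under eq_fun do rewrite block_mxEdl.
- by under eq_fun do rewrite block_mxEdr.
Qed.

Lemma differentiable_col_mx m1 m2 n (A : V -> 'M[R]_(m1, n)) (B : V -> 'M[R]_(m2, n)) x :
  differentiable A x -> differentiable B x ->
  differentiable (fun y => col_mx (A y) (B y)) x.
Proof.
move=> /differentiable_mxP dA /differentiable_mxP dB.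
apply/differentiable_mxP => i j; case: (split_ordP i) => i' ->.
- by under eq_fun do rewrite col_mxEu.
- by under eq_fun do rewrite col_mxEd.
Qed.

Lemma differentiable_scalemx m n (c : V -> R) (A : V -> 'M[R]_(m, n)) x :
  differentiable c x -> differentiable A x -> differentiable (fun y => c y *: A y) x.
Proof.
move=> dc /differentiable_mxP dA; apply/differentiable_mxP => i j.
under eq_fun do rewrite mxE.
exact: differentiableM.
Qed.

End DifferentiableBlocks.

Section DifferentiableMetrics.
Context {R : realType} {n : nat} {M : manifold R n}.
Implicit Types (gr grho : R -> components R (mindex M) n) (i : mindex M).

Lemma differentiable_ambient grho i (z : 'rV[R]_(1 + n + 1)) :
  differentiable (family_at grho i) (row_mx (rsubmx (lsubmx z)) (rsubmx z)) ->
  differentiable (ambient_metric grho i) z.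
Proof.
move=> dG.
have dt : differentiable (fun y : 'rV[R]_(1 + n + 1) => lsubmx (lsubmx y) 0 0) z.
  under eq_fun do rewrite !mxE.
  exact: differentiable_coord.
have drho : differentiable (fun y : 'rV[R]_(1 + n + 1) => rsubmx y 0 0) z.
  under eq_fun do rewrite !mxE.
  exact: differentiable_coord.
have dw : differentiable
    (fun y => row_mx (rsubmx (lsubmx y)) (rsubmx y) : 'rV[R]_(n + 1)) z.
  apply: differentiable_row_mx; last exact: differentiable_rsubmx.
  apply/differentiable_mxP => a b; under eq_fun do rewrite !mxE.
  exact: differentiable_coord.
apply: differentiable_block_mx; last exact: differentiable_cst.
- apply: differentiable_block_mx.
  + apply: differentiable_scalar_mx.
    exact: (differentiableM (differentiable_cst (2 : R) z) drho).
  + exact: differentiable_cst.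
  + exact: differentiable_cst.
  have := differentiable_scalemx (differentiable_sqr dt) (differentiable_comp dw dG).
  suff -> : (fun y : 'rV[R]_(1 + n + 1) => lsubmx (lsubmx y) 0 0 ^+ 2 *:
      (family_at grho i \o (fun y => row_mx (rsubmx (lsubmx y)) (rsubmx y))) y) =
    fun y => lsubmx (lsubmx y) 0 0 ^+ 2 *: grho (rsubmx y 0 0) i (rsubmx (lsubmx y)) by [].
  by apply/funext => y; rewrite /= /family_at row_mxKl row_mxKr.
- apply: differentiable_col_mx; last exact: differentiable_cst.
  exact: differentiable_scalar_mx.
- apply: differentiable_row_mx; last exact: differentiable_cst.
  exact: differentiable_scalar_mx.
Qed.

Lemma differentiable_poincare gr grho i (z : 'rV[R]_(n + 1)) :
  let r := rsubmx z 0 0 in r != 0 ->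
  (\forall y \near z, gr (rsubmx y 0 0) i (lsubmx y) =
                     grho (- (rsubmx y 0 0 ^+ 2 / 2)) i (lsubmx y)) ->
  differentiable (family_at grho i) (row_mx (lsubmx z) (- (r ^+ 2 / 2))%:M) ->
  differentiable (poincare_metric gr i) z.
Proof.
move=> r r0 grE dG; have dr := differentiable_last z.
pose phi (y : 'rV[R]_(n + 1)) : 'rV[R]_(n + 1) :=
  row_mx (lsubmx y) (- (rsubmx y 0 0 ^+ 2 / 2))%:M.
have dphi : differentiable phi z.
  apply: differentiable_row_mx; first exact: differentiable_lsubmx.
  apply: differentiable_scalar_mx.
  exact: (differentiableN (differentiableM (differentiable_sqr dr)
    (differentiable_cst (2^-1 : R) z))).
have dB : differentiable
    (fun y => block_mx ((family_at grho i \o phi) y) 0 0 1%:M : 'M[R]_(n + 1)) z.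
  apply: differentiable_block_mx; try exact: differentiable_cst.
  exact: differentiable_comp.
have r2 : (fun y : 'rV[R]_(n + 1) => rsubmx y 0 0 ^+ 2) z != 0 by exact: expf_neq0.
have := differentiable_scalemx (differentiableV (differentiable_sqr dr) r2) dB.
apply: near_eq_differentiable; apply: filterS grE => y yE.
by rewrite /poincare_metric yE /family_at /phi /= row_mxKl row_mxKr [_%:M 0 0]mxE.
Qed.

End DifferentiableMetrics.

Section BlockInverse.
Context {R : realType} {k : nat}.

Lemma unitmx_block_diag (H : 'M[R]_k) :
  H \in unitmx -> block_mx (-1)%:M 0 0 H \in @unitmx R (1 + k).
Proof.
move=> UH; rewrite unitmxE det_lblock det_scalar1 unitrM unitrN unitr1.
by rewrite -unitmxE.
Qed.

Lemma invmx_block_diag (H : 'M[R]_k) : H \in unitmx ->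
  invmx (block_mx (-1)%:M 0 0 H) = block_mx (-1)%:M 0 0 (invmx H) :> 'M[R]_(1 + k).
Proof.
move=> UH; rewrite -[RHS](mulKmx (unitmx_block_diag UH)).
rewrite mulmx_block !mul0mx !mulmx0 !addr0 !add0r mulmxV // -scalar_mxM mulrNN mulr1.
by rewrite -scalar_mx_block mulmx1.
Qed.

End BlockInverse.

(** * Comparison of the ambient metric on the cone with the Poincaré metric *)

Section ConeGeometry.
Context {R : realType} {n k : nat} {M : manifold R n}.
Variables (gr grho : R -> components R (mindex M) n) (i : mindex M).
Variables (f : 'rV[R]_k -> 'rV[R]_(n + 1)) (z : 'rV[R]_(1 + k)).
Implicit Types (v w : 'rV[R]_(n + 1)) (V W A B : 'rV[R]_(1 + n + 1)).
Let u := rsubmx z.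
Let s := lsubmx z 0 0.
Let x := lsubmx (f u).
Let r := rsubmx (f u) 0 0.
Let w0 : 'rV[R]_(n + 1) := row_mx x (- (r ^+ 2 / 2))%:M.
Let G0 := family_at grho i w0.
Let gp := poincare_metric gr i.
Let ga := ambient_metric grho i.
Let F := cone_lift f.
(** Derivative of the family in the direction that [v] induces on (x, rho); it occurs in the
    derivatives of both metrics. *)
Let D (v : 'rV[R]_(n + 1)) : 'M[R]_n :=
  'D_(row_mx (lsubmx v) (- (r * rsubmx v 0 0))%:M) (family_at grho i) w0.

Hypothesis r0 : r != 0.
Hypothesis s0 : s != 0.
Hypothesis df : {near u, forall u, differentiable f u}.
Hypothesis ddf : forall c j, differentiable (partial c (fun y => f y 0 j)) u.
Hypothesis grE : \forall y \near f u, gr (rsubmx y 0 0) i (lsubmx y) =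
                     grho (- (rsubmx y 0 0 ^+ 2 / 2)) i (lsubmx y).
Hypothesis dG : differentiable (family_at grho i) w0.
Hypothesis G0T : G0^T = G0.
Hypothesis gpU : gp (f u) \in unitmx.

Lemma G0E : grho (- (r ^+ 2 / 2)) i x = G0.
Proof. by rewrite /G0 /family_at /w0 row_mxKl row_mxKr [_%:M 0 0]mxE. Qed.

Lemma gpE : gp (f u) = r ^- 2 *: block_mx G0 0 0 1%:M.
Proof.
by rewrite /gp /poincare_metric (nbhs_singleton grE) -/r -/x G0E.
Qed.

Lemma gaE : ga (F z) = block_mx
  (block_mx (2 * - (r ^+ 2 / 2))%:M 0 0 ((s / r) ^+ 2 *: G0))
  (col_mx (s / r)%:M 0) (row_mx (s / r)%:M 0) 0.
Proof.
rewrite /ga /ambient_metric /F /cone_lift -/u -/s -/r -/x !(row_mxKl, row_mxKr).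
by rewrite ![_%:M 0 0]mxE !mulr1n G0E.
Qed.

Lemma gform_gp v w : gform (gp (f u)) v w =
  r ^- 2 * (gform G0 (lsubmx v) (lsubmx w) + rsubmx v 0 0 * rsubmx w 0 0).
Proof. by rewrite gpE gformZ gform_block_diag mul1r. Qed.

Lemma gform_ga V W : gform (ga (F z)) V W =
  let vt := lsubmx (lsubmx V) 0 0 in let vr := rsubmx V 0 0 in
  let wt := lsubmx (lsubmx W) 0 0 in let wr := rsubmx W 0 0 in
  - r ^+ 2 * vt * wt + s / r * (vt * wr + vr * wt) +
  (s / r) ^+ 2 * gform G0 (rsubmx (lsubmx V)) (rsubmx (lsubmx W)).
Proof.
rewrite gaE gform_ambient_block gformZ /=; congr (_ * _ * _ + _ + _).
by field.
Qed.

Lemma cone_tangentK omega v :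
  (lsubmx (lsubmx (cone_tangent r s omega v)) 0 0 =
     omega / r - s * rsubmx v 0 0 / r ^+ 2) *
  (rsubmx (lsubmx (cone_tangent r s omega v)) = lsubmx v) *
  (rsubmx (cone_tangent r s omega v) 0 0 = - (r * rsubmx v 0 0)).
Proof.
by rewrite /cone_tangent !(row_mxKl, row_mxKr) ![_%:M 0 0]mxE !mulr1n.
Qed.

(** This is the identity of the ambient metric with s^2 g_+ - ds^2, [omega] being the ds-component:
    the dt drho terms cancel the cross terms between [omega] and the r-component. *)
Lemma gform_cone omega omega' v w :
  gform (ga (F z)) (cone_tangent r s omega v) (cone_tangent r s omega' w) =
  - (omega * omega') + s ^+ 2 * gform (gp (f u)) v w.
Proof.
rewrite gform_ga /= !cone_tangentK gform_gp.
by move: (gform _ _ _) => q; field.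
Qed.

Lemma cone_tangent_surj V : exists omega v, V = cone_tangent r s omega v.
Proof.
(* Obtained by solving backwards: the rho-entry of [V] gives the r-component [- rho / r], and then
   the t-entry gives [omega]. *)
exists (r * lsubmx (lsubmx V) 0 0 - s * rsubmx V 0 0 / r ^+ 2).
exists (row_mx (rsubmx (lsubmx V)) (- rsubmx V 0 0 / r)%:M).
rewrite /cone_tangent !(row_mxKl, row_mxKr) ![_%:M 0 0]mxE !mulr1n.
rewrite -[LHS]hsubmxK -[lsubmx V in LHS]hsubmxK.
congr (row_mx (row_mx _ _) _); rewrite [LHS]mx11_scalar; congr (_%:M); by field.
Qed.

Lemma cone_tangent_inj omega omega' v v' :
  cone_tangent r s omega v = cone_tangent r s omega' v' -> v = v'.
Proof.
move=> E; have := congr1 (fun V => rsubmx (lsubmx V)) E.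
have := congr1 (fun V : 'rV[R]_(1 + n + 1) => rsubmx V 0 0) E.
rewrite !cone_tangentK => /oppr_inj/(mulfI r0) rE lE.
rewrite -[v]hsubmxK -[v']hsubmxK lE; congr row_mx.
by rewrite [LHS]mx11_scalar rE -mx11_scalar.
Qed.

(** Pairing with the ruling kills [omega]; pairing with vectors of zero ds-component kills the rest
    because [gp] is invertible and [s] is nonzero. *)
Lemma ga_unit : ga (F z) \in unitmx.
Proof.
apply: gform_unitmx => V V0; have [omega [v VE]] := cone_tangent_surj V.
have o0 : omega = 0.
  have := V0 (cone_tangent r s 1 0).
  by rewrite VE gform_cone gform0r mulr0 addr0 mulr1 => /eqP; rewrite oppr_eq0 => /eqP.
have v0 : v = 0.
  apply: (gform_inj gpU) => w; rewrite gform0l.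
  have := V0 (cone_tangent r s 0 w).
  rewrite VE gform_cone mulr0 oppr0 add0r => /eqP.
  by rewrite mulf_eq0 expf_eq0 (negPf s0) /= => /eqP.
rewrite VE o0 v0 /cone_tangent !mxE !(mul0r, mulr0, subr0, oppr0).
by rewrite [lsubmx _]linear0 !(raddf0, row_mx0).
Qed.

Lemma ga_sym : (ga (F z))^T = ga (F z).
Proof.
rewrite gaE !tr_block_mx !trmx0 !tr_row_mx !tr_col_mx !tr_scalar_mx !trmx0.
by rewrite [(_ *: G0)^T]linearZ /= G0T.
Qed.

Lemma gp_sym : (gp (f u))^T = gp (f u).
Proof. by rewrite gpE linearZ /= tr_block_mx !trmx0 tr_scalar_mx G0T. Qed.

Lemma gform_derive_gp v (a b : 'rV[R]_(n + 1)) : gform ('D_v gp (f u)) a b =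
  r ^- 2 * gform (D v) (lsubmx a) (lsubmx b) -
  2 * rsubmx v 0 0 / r ^+ 3 *
    (gform G0 (lsubmx a) (lsubmx b) + rsubmx a 0 0 * rsubmx b 0 0).
Proof.
have [_ ->] := is_derive_poincare v r0 grE dG.
rewrite gform_block_diag gformD gformN !gformZ -/x -/r -/w0 -/G0 -/(D v).
by move: (gform _ _ _) (gform _ _ _) => p q; ring.
Qed.

Lemma gform_derive_ga omega v A B :
  gform ('D_(cone_tangent r s omega v) ga (F z)) A B =
  let At := lsubmx (lsubmx A) 0 0 in let Ar := rsubmx A 0 0 in
  let Bt := lsubmx (lsubmx B) 0 0 in let Br := rsubmx B 0 0 in
  let tau := omega / r - s * rsubmx v 0 0 / r ^+ 2 in
  - 2 * r * rsubmx v 0 0 * At * Bt + tau * (At * Br + Ar * Bt) +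
  (s / r) ^+ 2 * gform (D v) (rsubmx (lsubmx A)) (rsubmx (lsubmx B)) +
  2 * (s / r) * tau * gform G0 (rsubmx (lsubmx A)) (rsubmx (lsubmx B)).
Proof.
have wE : row_mx (rsubmx (lsubmx (F z))) (rsubmx (F z)) = w0.
  by rewrite /F /cone_lift !(row_mxKl, row_mxKr).
have dG' : differentiable (family_at grho i)
  (row_mx (rsubmx (lsubmx (F z))) (rsubmx (F z))) by rewrite wE.
have [_ ->] := is_derive_ambient (cone_tangent r s omega v) dG'.
rewrite wE gform_ambient_block gformD; rewrite [in LHS]gformZ [in LHS]gformZ.
rewrite !cone_tangentK /=.
have -> : lsubmx (lsubmx (F z)) 0 0 = s / r.
  by rewrite /F /cone_lift !row_mxKl [_%:M 0 0]mxE.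
rewrite -/G0.
have -> : 'D_(row_mx (lsubmx v) (rsubmx (cone_tangent r s omega v)))
    (family_at grho i) w0 = D v by rewrite /cone_tangent row_mxKr.
by move: (gform _ _ _) (gform _ _ _) => p q; ring.
Qed.

(* L stands for the derivative of g, which unification would otherwise unfold. *)
Lemma cov_deriv_lowerE m k' (g : 'rV[R]_m -> 'M[R]_m) (h : 'rV[R]_k' -> 'rV[R]_m)
    (L : 'rV[R]_m -> 'M[R]_m) a b y (w : 'rV[R]_m) :
  (forall v' : 'rV[R]_m, 'D_v' g (h y) = L v') ->
  (g (h y))^T = g (h y) -> g (h y) \in unitmx -> differentiable g (h y) ->
  gform (g (h y)) (cov_deriv g h a b y) w =
  gform (g (h y)) (\row_j hess h y j a b) w +
  2^-1 * (gform (L (row a ('J h y))) (row b ('J h y)) w +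
          gform (L (row b ('J h y))) (row a ('J h y)) w -
          gform (L w) (row a ('J h y)) (row b ('J h y))).
Proof.
move=> LE gT gU dg; have := cov_deriv_lower a b w gT gU dg.
by rewrite /= !LE.
Qed.

Lemma differentiable_ga : differentiable ga (F z).
Proof.
apply: differentiable_ambient.
by rewrite /F /cone_lift !(row_mxKl, row_mxKr).
Qed.

Lemma cov_cone_lift0 : cov_deriv ga F (lshift k 0) (lshift k 0) z = 0.
Proof.
have [L LE] : exists L : 'rV[R]_(1 + n + 1) -> 'M[R]_(1 + n + 1),
  forall V, 'D_V ga (F z) = L V by exists (fun V => 'D_V ga (F z)).
have LC omega v A B := etrans (congr1 (fun X => gform X A B)
  (esym (LE (cone_tangent r s omega v)))) (gform_derive_ga omega v A B).
apply: (gform_inj ga_unit) => W; have [omega [v ->]] := cone_tangent_surj W.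
rewrite (cov_deriv_lowerE _ _ _ LE ga_sym ga_unit differentiable_ga).
rewrite /F (hess_cone_lift0 r0 df) (row_jacobian_cone_lift0 r0 df) -/F -/r -/s.
rewrite gform0l !LC /= !cone_tangentK.
(* The ruling has no component along [M], so every term in the family drops out; the surviving
   derivatives of the dt drho and rho dt^2 coefficients cancel. *)
have e0 : rsubmx (0 : 'rV[R]_(n + 1)) 0 0 = 0 by rewrite linear0 mxE.
have l0 : lsubmx (0 : 'rV[R]_(n + 1)) = 0 by rewrite linear0.
move: (D 0) (D v) G0 => D0 Dv G; rewrite e0 l0 !gform0l.
by field.
Qed.

(** The ds-component comes from the s-dependence of s^2 g_+: the Koszul pairing with the ruling is
    minus half the s-derivative of s^2 g_+(A, B), and the ruling has square -1. *)
Lemma cov_cone_lift a b : cov_deriv ga F (rshift 1 a) (rshift 1 b) z =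
  cone_tangent r s (s * gform (gp (f u)) (row a ('J f u)) (row b ('J f u)))
    (cov_deriv gp f a b u).
Proof.
have [L LE] : exists L : 'rV[R]_(1 + n + 1) -> 'M[R]_(1 + n + 1),
  forall V, 'D_V ga (F z) = L V by exists (fun V => 'D_V ga (F z)).
have LC omega v A B := etrans (congr1 (fun X => gform X A B)
  (esym (LE (cone_tangent r s omega v)))) (gform_derive_ga omega v A B).
have [K KE] : exists K : 'rV[R]_(n + 1) -> 'M[R]_(n + 1),
  forall v, 'D_v gp (f u) = K v by exists (fun v => 'D_v gp (f u)).
have KC v v1 v2 := etrans (congr1 (fun X => gform X v1 v2) (esym (KE v)))
  (gform_derive_gp v v1 v2).
apply: (gform_inj ga_unit) => W; have [omega [v ->]] := cone_tangent_surj W.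
rewrite (cov_deriv_lowerE _ _ _ LE ga_sym ga_unit differentiable_ga).
rewrite gform_cone (cov_deriv_lowerE _ _ _ KE gp_sym gpU (differentiable_poincare r0 grE dG)).
rewrite /F (hess_cone_lift r0 df ddf) !(row_jacobian_cone_lift r0 df) -/F -/r -/s -/u.
move: (row a ('J f u)) (row b ('J f u)) => A B.
move: (\row_j hess f u j a b) => H.
rewrite !KC !LC /= !cone_tangentK !gform_gp gform_ga /=.
rewrite /cone_tangent_deriv !(row_mxKl, row_mxKr) ![_%:M 0 0]mxE !mulr1n ?cone_tangentK.
(* Once all pairings of the family and of its derivatives are generalized to scalars, an identity of
   rational functions in [r] and [s] is left. *)
move: (D A) (D B) (D v) G0 => DA DB Dv G.
move: (gform DA _ _) (gform DB _ _) (gform Dv _ _) => p1 p2 p3.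
move: (gform G _ _) (gform G _ _) (gform G _ _) (gform G _ _) => q1 q2 q3 q4.
move: (rsubmx A 0 0) (rsubmx B 0 0) (rsubmx v 0 0) (rsubmx H 0 0) => a' b' v' h'.
by field.
Qed.

Lemma first_form_cone_lift : first_form ga F z =
  block_mx (-1)%:M 0 0 (s ^+ 2 *: first_form gp f u) :> 'M[R]_(1 + k).
Proof.
apply/matrixP => a b; rewrite first_formE.
case: (split_ordP a) => a' ->; case: (split_ordP b) => b' ->.
- rewrite block_mxEul !ord1 (row_jacobian_cone_lift0 r0 df) gform_cone.
  by rewrite gform0l mulr0 addr0 mulr1 mxE eqxx.
- rewrite block_mxEur !ord1 (row_jacobian_cone_lift0 r0 df).
  rewrite (row_jacobian_cone_lift r0 df) gform_cone.
  by rewrite gform0l !mulr0 oppr0 addr0 mxE.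
- rewrite block_mxEdl !ord1 (row_jacobian_cone_lift0 r0 df).
  rewrite (row_jacobian_cone_lift r0 df) gform_cone.
  by rewrite gform0r !mulr0 mul0r oppr0 addr0 mxE.
- rewrite block_mxEdr !(row_jacobian_cone_lift r0 df) gform_cone.
  by rewrite mul0r oppr0 add0r mxE first_formE.
Qed.

Lemma cone_tangentZ c omega v :
  c *: cone_tangent r s omega v = cone_tangent r s (c * omega) (c *: v).
Proof.
rewrite /cone_tangent !scale_row_mx !scale_scalar_mx [lsubmx (c *: v)]linearZ /=.
rewrite [rsubmx (c *: v)]linearZ /= [(c *: rsubmx v) 0 0]mxE.
by congr (row_mx (row_mx _%:M _) _%:M); ring.
Qed.

Lemma cone_tangentD omega omega' v w :
  cone_tangent r s omega v + cone_tangent r s omega' w =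
  cone_tangent r s (omega + omega') (v + w).
Proof.
rewrite /cone_tangent !add_row_mx -!raddfD /=.
rewrite [rsubmx (v + w)]linearD /= [(rsubmx v + rsubmx w) 0 0]mxE.
by congr (row_mx (row_mx _%:M _) _%:M); ring.
Qed.

Lemma cone_tangent0 : cone_tangent r s 0 (0 : 'rV[R]_(n + 1)) = 0.
Proof.
have := cone_tangentZ 0 0 (0 : 'rV[R]_(n + 1)).
by rewrite scale0r mul0r scale0r.
Qed.

Lemma cone_tangent_sum (I : Type) (t : seq I) (omega : I -> R) (w : I -> 'rV[R]_(n + 1)) :
  \sum_(j <- t) cone_tangent r s (omega j) (w j) =
  cone_tangent r s (\sum_(j <- t) omega j) (\sum_(j <- t) w j).
Proof.
elim: t => [|j t IH]; first by rewrite !big_nil cone_tangent0.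
by rewrite !big_cons IH cone_tangentD.
Qed.

(** Describes the tangent space of the cone: the ds-component is free, and the other component is
    tangent to the cross-section. *)
Lemma mul_jacobian_cone_lift (W : 'rV[R]_(1 + k)) :
  W *m 'J F z = cone_tangent r s (lsubmx W 0 0) (rsubmx W *m 'J f u).
Proof.
rewrite mulmx_sum_row big_split_ord big_ord1 /=.
rewrite (row_jacobian_cone_lift0 r0 df) -/r -/s cone_tangentZ scaler0 mulr1.
under eq_bigr => a _.
  rewrite (row_jacobian_cone_lift r0 df) -/r -/s -/u cone_tangentZ mulr0; over.
rewrite cone_tangent_sum cone_tangentD big1 // addr0 add0r; congr cone_tangent.
  by rewrite mxE.
by rewrite mulmx_sum_row; apply: eq_bigr => a _; rewrite mxE.
Qed.

Hypothesis hU : first_form gp f u \in unitmx.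

Lemma first_form_cone_unit : first_form ga F z \in unitmx.
Proof.
rewrite first_form_cone_lift; apply: unitmx_block_diag.
by rewrite unitmxZ // unitfE expf_neq0.
Qed.

(** [omega] is left existential since a component along the ruling is tangent to the cone and cannot
    affect minimality. *)
Lemma cov_trace_cone_lift : exists omega,
  cov_trace ga F z = cone_tangent r s omega (s ^- 2 *: cov_trace gp f u).
Proof.
have sU : s ^+ 2 \is a GRing.unit by rewrite unitfE expf_neq0.
have trE : s ^- 2 *: cov_trace gp f u = \sum_a \sum_b
    (s ^- 2 * invmx (first_form gp f u) a b) *: cov_deriv gp f a b u.
  rewrite /cov_trace scaler_sumr; apply: eq_bigr => a _.
  by rewrite scaler_sumr; apply: eq_bigr => b _; rewrite scalerA.
have shU : s ^+ 2 *: first_form gp f u \in unitmx by rewrite unitmxZ.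
rewrite {1}/cov_trace first_form_cone_lift invmx_block_diag // invmxZ //.
rewrite big_split_ord big_ord1 big_split_ord big_ord1 /=.
rewrite cov_cone_lift0 scaler0 add0r big1 ?add0r; last first.
  by move=> b _; rewrite block_mxEur mxE scale0r.
under eq_bigr => a _.
  rewrite big_split_ord big_ord1 /= block_mxEdl mxE scale0r add0r.
  under eq_bigr => b _ do rewrite block_mxEdr mxE cov_cone_lift cone_tangentZ.
  rewrite cone_tangent_sum; over.
rewrite cone_tangent_sum trE; by eexists.
Qed.

(* A cone is minimal iff its cross-section is: the ruling contributes nothing to
   the trace, and the other terms only pick up a component along the ruling. *)
Lemma mean_curvature_cone_lift :
  mean_curvature ga F z = 0 <-> mean_curvature gp f u = 0.
Proof.
have [omega E] := cov_trace_cone_lift.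
split=> [/(mean_curvature_eq0 first_form_cone_unit)[W]|/(mean_curvature_eq0 hU)[w wE]].
  rewrite E mul_jacobian_cone_lift => /cone_tangent_inj wE.
  apply/(mean_curvature_eq0 hU); exists (s ^+ 2 *: rsubmx W).
  by rewrite -scalemxAl -wE scalerA mulfV ?scale1r // expf_neq0.
apply/(mean_curvature_eq0 first_form_cone_unit).
exists (row_mx omega%:M (s ^- 2 *: w)).
rewrite E wE mul_jacobian_cone_lift row_mxKl row_mxKr [_%:M 0 0]mxE mulr1n.
by rewrite scalemxAl.
Qed.

End ConeGeometry.

(** * Local parametrizations *)

Section LocalParamChange.
Context {R : realType} {T : topologicalType} {I : Type} {m k : nat}.
Variable A : I -> chart R T m.

(** The Moore-Penrose right inverse of [J2] recovers the factor [B] by a formula that can be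
    differentiated. *)
Lemma gram_factor (J1 J2 : 'M[R]_(k, m)) (B : 'M[R]_k) :
  J1 = B *m J2 -> J2 *m J2^T \in unitmx ->
  J1 *m (J2^T *m invmx (J2 *m J2^T)) = B.
Proof. by move=> -> U; rewrite mulmxA -(mulmxA B) mulmxK. Qed.

Lemma unitmx_factor (J1 J2 : 'M[R]_(k, m)) (B : 'M[R]_k) :
  J1 = B *m J2 -> row_free J1 -> B \in unitmx.
Proof.
by move=> -> /row_freeP[C]; rewrite -mulmxA => /mulmx1_unit[].
Qed.

Lemma open_param_domain (V : set 'rV[R]_k) (F : 'rV[R]_k -> T) (D : set T) :
  open V -> (forall u, V u -> {for u, continuous F}) -> open D ->
  open (V `&` F @^-1` D).
Proof.
move=> oV cF oD; rewrite openE => u [Vu Du]; apply: filterI.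
  exact: open_nbhs_nbhs.
by apply: cF => //; exact: open_nbhs_nbhs.
Qed.

Lemma differentiable_jacobian (f : 'rV[R]_k -> 'rV[R]_m) (S : set 'rV[R]_k) u :
  open S -> smooth_on S f -> S u -> differentiable (fun y => 'J f y) u.
Proof.
move=> oS sf Su; apply/differentiable_mxP => a j.
have /(smooth_on_mxP _ oS)/(_ 0 j)/(smooth_on_partial a) := sf.
move=> /smooth_on_diff/(_ Su); apply: near_eq_differentiable.
apply: filterS (open_nbhs_nbhs (conj oS Su)) => y Sy.
by rewrite jacobianE //; exact: smooth_on_diff Sy.
Qed.

Variables (Y : set T) (g : 'rV[R]_m -> 'M[R]_m).
Variables (V1 V2 : set 'rV[R]_k) (F1 F2 : 'rV[R]_k -> T).
Hypothesis P1 : local_param A Y V1 F1.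
Hypothesis P2 : local_param A Y V2 F2.

(* No inverse function theorem is needed for the change of parameters phi: it is
   continuous because F2 is a homeomorphism onto its image, and a continuous
   factorization through an immersion is differentiable. *)
Lemma mean_curvature_local_param i u1 u2 :
  open (cdom (A i)) -> V1 u1 -> V2 u2 -> F2 u2 = F1 u1 -> cdom (A i) (F1 u1) ->
  first_form g (cmap (A i) \o F2) u2 \in unitmx ->
  first_form g (cmap (A i) \o F1) u1 \in unitmx /\
  (mean_curvature g (cmap (A i) \o F2) u2 = 0 ->
   mean_curvature g (cmap (A i) \o F1) u1 = 0).
Proof.
move=> oD V1u1 V2u2 F21 Du1 U2.
have [[oV1 cF1] [W1 oW1 F1W] _ /(_ i) smooth1 /(_ i) rk1] := P1.
have [[oV2 cF2] [W2 oW2 F2W] [G2 cG2 G2K] /(_ i) smooth2 /(_ i) rk2] := P2.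
set f1 := cmap (A i) \o F1 in smooth1 rk1 *.
set f2 := cmap (A i) \o F2 in U2 smooth2 rk2 *.
set S1 := V1 `&` F1 @^-1` cdom (A i) in smooth1.
set S2 := V2 `&` F2 @^-1` cdom (A i) in smooth2.
have oS1 : open S1 by exact: open_param_domain.
have oS2 : open S2 by exact: open_param_domain.
pose phi := G2 \o F1.
(* On [S] the values of [F1] lie in [Y] and in [W2], hence in the image of [F2], where [G2] really
   inverts [F2]. *)
pose S := V1 `&` F1 @^-1` (W2 `&` cdom (A i)).
have oS : open S by apply: open_param_domain => //; exact: openI.
have S1S u : S u -> S1 u by case=> Vu [_ Du].
have FV u : V1 u -> W2 (F1 u) -> (F2 @` V2) (F1 u).
  move=> Vu Wu; rewrite F2W; split=> //.
  have : (F1 @` V1) (F1 u) by exists u.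
  by rewrite F1W; case.
have phiP u : S u -> S2 (phi u) /\ F2 (phi u) = F1 u.
  move=> [Vu [Wu Du]]; have [v V2v vE] := FV u Vu Wu.
  have E : phi u = v by rewrite /phi /= -vE G2K.
  by rewrite E; split=> //; split=> //=; rewrite vE.
have nS u : S u -> \forall y \near u, S y by move=> Su; exact: open_nbhs_nbhs.
(* [G2] is continuous only within the image of [F2]; openness of [S] keeps [F1] in that image near
   [u]. *)
have cphi u : S u -> {for u, continuous phi}.
  move=> Su B nB; have [Vu [Wu Du]] := Su.
  have := (subspace_continuousP _ _).1 cG2 _ (FV u Vu Wu) B nB.
  move=> /(cF1 u Vu) nB1; have nSu := nS u Su.
  suff : \forall y \near u, B (phi y) by [].
  have nB2 : \forall y \near u, (F2 @` V2) (F1 y) -> B (G2 (F1 y)) by exact: nB1.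
  near=> y; have [Vy [Wy Dy]] : S y by near: y.
  by apply: (near nB2 y) => //; exact: FV.
have f12 u : S u -> f2 (phi u) = f1 u.
  by move=> /phiP[_ E]; rewrite /f2 /f1 /= E.
have df1 u : S u -> differentiable f1 u.
  by move=> /S1S; exact: smooth_on_diff.
have df2 u : S u -> differentiable f2 (phi u).
  by move=> /phiP[S2u _]; exact: smooth_on_diff S2u.
have rf1 u : S u -> row_free ('J f1 u).
  by move=> /S1S[Vu Du]; rewrite /row_free rk1.
have rf2 u : S u -> row_free ('J f2 (phi u)).
  by move=> /phiP[[Vu Du] _]; rewrite /row_free rk2.
have dphi u : S u -> differentiable phi u.
  move=> Su; apply: (row_free_differentiable_factor (cphi u Su) _ (df1 u Su) (df2 u Su)).
    by apply: filterS (nS u Su) => y /f12.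
  exact: rf2.
have J12 u : S u -> 'J f1 u = 'J phi u *m 'J f2 (phi u).
  move=> Su; apply: etrans (jacobian_comp (dphi u Su) (df2 u Su)); apply/esym.
  apply: near_eq_jacobian.
    by apply: differentiable_comp; [exact: dphi | exact: df2].
  by apply: filterS (nS u Su) => y; exact: f12.
have Su1 : S u1.
  split=> //; split=> //=.
  have : (F2 @` V2) (F1 u1) by exists u2.
  by rewrite F2W; case.
have phiu1 : phi u1 = u2 by rewrite /phi /= -F21 G2K.
(* The Euclidean Gram matrix is invertible by the rank condition alone, whatever the signature of
   [g]. *)
pose gram v := 'J f2 v *m ('J f2 v)^T.
have gramU u : S u -> gram (phi u) \in unitmx.
  move=> Su; have := @posdef_gram_unit R k m 1%:M ('J f2 (phi u)) _ (rf2 u Su).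
  rewrite mulmx1; apply; split; first exact: trmx1.
  move=> v v0; rewrite mulmx1 mxE; have [j vj] : exists j, v 0 j != 0.
    apply/existsP; apply: contraNT v0 => /existsPn v0; apply/eqP/rowP => j.
    by rewrite mxE; have /negPn/eqP := v0 j.
  rewrite (bigD1 j) //= mxE; apply: ltr_pwDl; first by rewrite -expr2 exprn_even_gt0.
  by apply: sumr_ge0 => l _; rewrite mxE -expr2 sqr_ge0.
(* Second differentiability of [phi]: its Jacobian is expressed through those of [f1] and [f2],
   which are differentiable by smoothness, composed with the already differentiable [phi]. *)
have dJphi : differentiable (fun u => 'J phi u) u1.
  apply: (@near_eq_differentiable _ _ _ (fun u => 'J f1 u *m
    (('J f2 (phi u))^T *m invmx (gram (phi u))))).
    apply: filterS (nS u1 Su1) => u Su.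
    exact: (gram_factor (J12 u Su) (gramU u Su)).
  apply: differentiable_mulmx; first exact: differentiable_jacobian (S1S _ Su1).
  have dJ2 : differentiable (fun u => 'J f2 (phi u)) u1.
    apply: (@differentiable_comp _ _ _ _ phi (fun v => 'J f2 v)); first exact: dphi.
    exact: differentiable_jacobian (phiP _ Su1).1.
  apply: differentiable_mulmx; first exact: differentiable_trmx.
  apply: differentiable_invmx.
    by apply: differentiable_mulmx => //; exact: differentiable_trmx.
  by apply: filterS (nS u1 Su1) => u; exact: gramU.
rewrite -phiu1 in U2 *.
apply: (mean_curvature_comp (g := g) (f1 := f1) (f2 := f2) (phi := phi) (u := u1)).
- by apply: filterS (nS u1 Su1) => u; exact: f12.
- by apply: filterS (nS u1 Su1) => u; exact: dphi.
- have := open_nbhs_nbhs (conj oS2 (phiP u1 Su1).1).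
  by apply: filterS => v; exact: smooth_on_diff.
- move=> b c; move/differentiable_mxP : dJphi => /(_ b c).
  apply: near_eq_differentiable; apply: filterS (nS u1 Su1) => u Su.
  by rewrite jacobianE //; exact: dphi.
- move=> c j; have /(smooth_on_mxP _ oS2)/(_ 0 j)/(smooth_on_partial c) := smooth2.
  by move=> /smooth_on_diff; apply; exact: (phiP u1 Su1).1.
- exact: unitmx_factor (J12 u1 Su1) (rf1 u1 Su1).
- exact: U2.
Unshelve. all: by end_near. Qed.

End LocalParamChange.

(** * Cone parametrizations of the homogeneous lift *)

Section HomogeneousLift.
Context {R : realType} {n : nat} {M : manifold R n}.
Variables (g : components R (mindex M) n) (e0 e : R).
Variables (gr grho : R -> components R (mindex M) n).
Hypothesis e0_gt0 : 0 < e0.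
Hypothesis e0e : e0 ^+ 2 <= 2 * e.
Hypothesis corr : corresponding_ambient g e0 gr e grho.

Definition regular_coords (i : mindex M) (w : 'rV[R]_(n + 1)) :=
  cimg (matlas i) (lsubmx w) /\ 0 < rsubmx w 0 0 < e0.

(** The purpose of [e0e]: the whole cone over a subset of M x (0, e0) fits into the range of rho. *)
Lemma rho_bound r : 0 < r < e0 -> - e < - (r ^+ 2 / 2) < 0.
Proof.
move=> /andP[r_gt0 re0]; have : r ^+ 2 < e0 ^+ 2 by rewrite ltr_pXn2r ?nnegrE ?ltW.
have : 0 < r ^+ 2 by rewrite exprn_gt0.
by move: (r ^+ 2) e0e => q; lra.
Qed.

Lemma regular_near i w : regular_coords i w -> \forall y \near w, regular_coords i y.
Proof.
move=> [xi r_itv]; apply: filterI.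
  have [[_ oi] _ _ _] := manifold_chart i.
  exact: (@continuous_lsubmx R 1 n 1 w _ (open_nbhs_nbhs (conj oi xi))).
have c := differentiable_continuous (differentiable_last w).
move: r_itv => /andP[r_gt0 re0].
near=> y; apply/andP; split.
  by near: y; exact: (cvgr_gt _ c _ r_gt0).
by near: y; exact: (cvgr_lt _ c _ re0).
Unshelve. all: by end_near. Qed.

Lemma near_family_eq i w : regular_coords i w ->
  \forall y \near w, gr (rsubmx y 0 0) i (lsubmx y) =
                     grho (- (rsubmx y 0 0 ^+ 2 / 2)) i (lsubmx y).
Proof.
move=> /regular_near; apply: filterS => y [xi /andP[r_gt0 re0]].
by have [_ _ _] := corr; apply => //; rewrite ltW.
Qed.

Lemma family_differentiable i w : regular_coords i w ->
  differentiable (family_at grho i)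
    (row_mx (lsubmx w) (- (rsubmx w 0 0 ^+ 2 / 2))%:M).
Proof.
move=> [xi r_itv]; have /andP[b1 b2] := rho_bound r_itv.
have [_ _ /(_ i) sm _] := corr.
apply: (smooth_on_diff sm); rewrite /= row_mxKl row_mxKr [_%:M 0 0]mxE mulr1n.
split=> //; rewrite b1 /=; move: b1 b2; move: (_ ^+ 2) => q; lra.
Qed.

Lemma family_posdef i w : regular_coords i w ->
  posdef (family_at grho i (row_mx (lsubmx w) (- (rsubmx w 0 0 ^+ 2 / 2))%:M)).
Proof.
move=> [xi r_itv]; have /andP[b1 b2] := rho_bound r_itv.
have [/(_ (- (rsubmx w 0 0 ^+ 2 / 2))) rm _ _ _] := corr.
rewrite /family_at row_mxKl row_mxKr [_%:M 0 0]mxE mulr1n.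
have [_ pd _] : riemannian_metric (grho (- (rsubmx w 0 0 ^+ 2 / 2))).
  by apply: rm; rewrite b1 /=; move: b1 b2; move: (_ ^+ 2) => q; lra.
exact: pd.
Qed.

Lemma poincare_posdef i w : regular_coords i w -> posdef (poincare_metric gr i w).
Proof.
move=> rw; have [G0T G0pos] := family_posdef rw.
have r0 : rsubmx w 0 0 != 0 by have [_ /andP[/gt_eqF->]] := rw.
have E : poincare_metric gr i w = (rsubmx w 0 0) ^- 2 *: block_mx
   (family_at grho i (row_mx (lsubmx w) (- (rsubmx w 0 0 ^+ 2 / 2))%:M)) 0 0 1%:M.
  rewrite /poincare_metric (nbhs_singleton (near_family_eq rw)).
  by rewrite /family_at row_mxKl row_mxKr [_%:M 0 0]mxE mulr1n.
rewrite E; move: (family_at _ _ _) G0T G0pos => G0 G0T G0pos.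
split; first by rewrite linearZ /= tr_block_mx !trmx0 tr_scalar_mx G0T.
move=> v v0; rewrite -/(gform _ v v) gformZ gform_block_diag mul1r.
apply: mulr_gt0; first by rewrite invr_gt0 exprn_even_gt0.
have [vx0|vx0] := eqVneq (lsubmx v) 0; last first.
  by apply: ltr_pwDl; [exact: G0pos | rewrite -expr2 sqr_ge0].
rewrite vx0 gform0l add0r -expr2 exprn_even_gt0 //.
apply: contraNneq v0 => vr0; rewrite -[v]hsubmxK vx0 [rsubmx v]mx11_scalar vr0.
by rewrite raddf0 row_mx0.
Qed.

Lemma poincare_unit i w : regular_coords i w -> poincare_metric gr i w \in unitmx.
Proof.
move=> /poincare_posdef pd.
have := posdef_gram_unit (J := 1%:M) pd; rewrite trmx1 mulmx1 mul1mx; apply.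
by rewrite row_free_unit unitmx1.
Qed.

Lemma open_ambient_dom i : open (cdom (ambient_atlas M e i)).
Proof.
have [[od _] _ _ _] := manifold_chart i.
rewrite (_ : cdom _ = (fun q : R * M * R => q.1.1) @^-1` [set t | 0 < t] `&`
   ((fun q : R * M * R => q.1.2) @^-1` cdom (matlas i) `&`
   ((fun q : R * M * R => q.2) @^-1` [set t | - e < t] `&`
    (fun q : R * M * R => q.2) @^-1` [set t | t < e]))); last first.
  apply/seteqP; split=> q /=; first by case=> ? ? /andP[].
  by move=> [? [? [? ?]]]; split=> //; apply/andP.
have c1 : continuous (fun q : R * M * R => q.1.1).
  by move=> q; apply: (@continuous_comp _ _ _ fst fst); exact: cvg_fst.
have c2 : continuous (fun q : R * M * R => q.1.2).
  by move=> q; apply: (@continuous_comp _ _ _ fst snd); [exact: cvg_fst | exact: cvg_snd].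
have c3 : continuous (fun q : R * M * R => q.2) by move=> q; exact: cvg_snd.
apply: openI; first by move/continuousP : c1; apply; exact: open_gt.
apply: openI; first by move/continuousP : c2; apply.
by apply: openI; move/continuousP : c3; apply; [exact: open_gt | exact: open_lt].
Qed.

End HomogeneousLift.

Section Continuity.

Lemma continuous_pair (S T U : topologicalType) (f : S -> T) (h : S -> U) x :
  {for x, continuous f} -> {for x, continuous h} ->
  {for x, continuous (fun y => (f y, h y))}.
Proof. by move=> cf ch; exact: (cvg_pair cf ch). Qed.

Lemma cvg_row_mx_scalar (R : realType) (T : Type) (Fi : set_system T) k
    (c : T -> R) (B : T -> 'rV[R]_k) c0 B0 : Filter Fi ->
  c y @[y --> Fi] --> c0 -> B y @[y --> Fi] --> B0 ->
  row_mx (c y)%:M (B y) @[y --> Fi] --> (row_mx c0%:M B0 : 'rV[R]_(1 + k)).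
Proof.
move=> FF hc hB.
have E (a : R) (b : 'rV[R]_k) : row_mx a%:M b =
    a *: row_mx 1%:M 0 + mulmxr (row_mx 0 1%:M) b :> 'rV[R]_(1 + k).
  rewrite /= mul_mx_row mulmx0 mulmx1 scale_row_mx scaler0 add_row_mx addr0 add0r.
  by rewrite scale_scalar_mx mulr1.
under eq_fun do rewrite E; rewrite E; apply: cvgD; first exact: cvgZr_tmp.
exact: (cvg_comp _ _ hB (@continuous_mulmxr R 1 _ _ (row_mx 0 1%:M) B0)).
Qed.

End Continuity.

Section LiftedParam.
Context {R : realType} {n : nat} {M : manifold R n}.
Variables (g : components R (mindex M) n) (e0 e : R).
Variables (gr grho : R -> components R (mindex M) n).
Hypothesis e0_gt0 : 0 < e0.
Hypothesis e0e : e0 ^+ 2 <= 2 * e.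
Hypothesis corr : corresponding_ambient g e0 gr e grho.
Variables (k : nat) (Y : set (M * R)).
Hypothesis subY : submanifold (poincare_atlas M e0) k Y.
Variables (V : set 'rV[R]_k) (F : 'rV[R]_k -> (M * R)%type).
Hypothesis PF : local_param (poincare_atlas M e0) Y V F.

(** Chart-free form of [cone_lift], as a local parametrization must be one map into the manifold for
    all charts. *)
Definition lift_param (z : 'rV[R]_(1 + k)) : (R * M * R)%type :=
  let q := F (rsubmx z) in (lsubmx z 0 0 / q.2, q.1, - (q.2 ^+ 2 / 2)).

Definition lift_domain : set 'rV[R]_(1 + k) :=
  [set z | 0 < lsubmx z 0 0 /\ V (rsubmx z)].

Let fc i := cmap (poincare_atlas M e0 i) \o F.

Lemma param_in u : V u -> Y (F u).
Proof.
move=> Vu; have [_ [W _ FW] _ _ _] := PF.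
have : (F @` V) (F u) by exists u.
by rewrite FW; case.
Qed.

Lemma param_r u : V u -> 0 < (F u).2 < e0.
Proof. by move=> /param_in /(subY.1)[i []]. Qed.

Lemma open_poincare_dom i : open (cdom (poincare_atlas M e0 i)).
Proof.
have [[od _] _ _ _] := manifold_chart i.
rewrite (_ : cdom _ = (fun q : M * R => q.1) @^-1` cdom (matlas i) `&`
   ((fun q : M * R => q.2) @^-1` [set t | 0 < t] `&`
    (fun q : M * R => q.2) @^-1` [set t | t < e0])); last first.
  apply/seteqP; split=> q /=; first by case=> ? /andP[].
  by move=> [? [? ?]]; split=> //; apply/andP.
have c1 : continuous (fun q : M * R => q.1) by move=> q; exact: cvg_fst.
have c2 : continuous (fun q : M * R => q.2) by move=> q; exact: cvg_snd.
apply: openI; first by move/continuousP : c1; apply.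
by apply: openI; move/continuousP : c2; apply; [exact: open_gt | exact: open_lt].
Qed.

Lemma chart_lift i : cmap (ambient_atlas M e i) \o lift_param = cone_lift (fc i).
Proof.
apply/funext => z; rewrite /cone_lift /= /fc /= row_mxKl row_mxKr.
by rewrite [_%:M 0 0]mxE mulr1n.
Qed.

Lemma regular_param i u : V u -> cdom (poincare_atlas M e0 i) (F u) ->
  regular_coords e0 i (fc i u).
Proof.
move=> Vu [Du r_itv]; rewrite /fc /regular_coords /= row_mxKl row_mxKr.
by rewrite [_%:M 0 0]mxE mulr1n; split=> //; exists (F u).1.
Qed.

Lemma lift_cdom i z : lift_domain z -> cdom (ambient_atlas M e i) (lift_param z) ->
  cdom (poincare_atlas M e0 i) (F (rsubmx z)).
Proof. by move=> [_ Vz] [_ Dz _]; split=> //; exact: param_r. Qed.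

Lemma lift_paramP z : lift_domain z ->
  homogeneous_lift e Y (lift_param z) /\ ambient_proj (lift_param z) = F (rsubmx z).
Proof.
move=> [s_gt0 Vz]; have r_itv := param_r Vz.
have /andP[b1 b2] := rho_bound e0_gt0 e0e r_itv.
have /andP[r_gt0 _] := r_itv.
have E : ambient_proj (lift_param z) = F (rsubmx z).
  rewrite /ambient_proj /lift_param /=.
  have -> : -2 * - ((F (rsubmx z)).2 ^+ 2 / 2) = (F (rsubmx z)).2 ^+ 2 by field.
  by rewrite sqrtr_sqr gtr0_norm //; case: (F _).
split=> //; split; first by split=> /=; rewrite ?divr_gt0 // b1 ltW.
by rewrite /= E; exact: param_in.
Qed.

(** The parameter is s = t r. The sign condition on rho in the lift makes the square of the root
    equal to - 2 rho, so that rho is recovered. *)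
Lemma lift_param_surj q u : homogeneous_lift e Y q -> V u -> F u = ambient_proj q ->
  let z := row_mx (q.1.1 * (F u).2)%:M u in lift_domain z /\ lift_param z = q.
Proof.
move=> [[t_gt0 /andP[_ rho_le0]] _] Vu uE z; have /andP[r_gt0 _] := param_r Vu.
have rE : (F u).2 ^+ 2 = -2 * q.2.
  by rewrite uE sqr_sqrtr //; move: rho_le0; lra.
have pE : (F u).1 = q.1.2 by rewrite uE.
rewrite /lift_domain /lift_param /z /= row_mxKl row_mxKr [_%:M 0 0]mxE mulr1n.
split; first by split=> //; exact: mulr_gt0.
rewrite rE pE mulfK ?gt_eqF //; case: q rE pE {t_gt0 rho_le0 uE z} => [[t p] rho] /= _ _.
by congr (_, _, _); field.
Qed.

Lemma ambient_proj_continuous : continuous (@ambient_proj R n M).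
Proof.
move=> q; apply: (@continuous_pair _ _ _ (fun q : R * M * R => q.1.2)
  (fun q : R * M * R => Num.sqrt (- 2 * q.2))).
  by apply: (@continuous_comp _ _ _ fst snd); [exact: cvg_fst | exact: cvg_snd].
apply: (@continuous_comp _ _ _ (fun q : R * M * R => - 2 * q.2) Num.sqrt).
  by apply: cvgMl_tmp; exact: cvg_snd.
exact: sqrt_continuous.
Qed.

Lemma lift_param_continuous z : lift_domain z -> {for z, continuous lift_param}.
Proof.
move=> [_ Vz]; have [[_ /(_ _ Vz) cF] _ _ _ _] := PF.
have /andP[r_gt0 _] := param_r Vz.
have cFz : {for z, continuous (F \o rsubmx)}.
  exact: (continuous_comp (@continuous_rsubmx R 1 1 k z) cF).
have c1 : {for z, continuous (fun z : 'rV[R]_(1 + k) => (F (rsubmx z)).1)}.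
  exact: (cvg_comp _ _ cFz cvg_fst).
have c2 : {for z, continuous (fun z : 'rV[R]_(1 + k) => (F (rsubmx z)).2)}.
  exact: (cvg_comp _ _ cFz cvg_snd).
have cs : {for z, continuous (fun z : 'rV[R]_(1 + k) => lsubmx z 0 0)}.
  apply: differentiable_continuous.
  by have /differentiable_mxP := @differentiable_lsubmx R 1 1 k z.
have r0 : (F (rsubmx z)).2 != 0 by rewrite gt_eqF.
have c3 : {for z, continuous (fun z : 'rV[R]_(1 + k) => lsubmx z 0 0 / (F (rsubmx z)).2)}.
  exact: (cvgM cs (cvgV r0 c2)).
have c4 : {for z, continuous (fun z : 'rV[R]_(1 + k) => - ((F (rsubmx z)).2 ^+ 2 / 2))}.
  have sq : differentiable (fun t : R => t ^+ 2) (F (rsubmx z)).2.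
    by apply: differentiable_sqr.
  have := differentiableN (differentiableM sq (differentiable_cst (2^-1 : R) _)).
  by move=> /differentiable_continuous; exact: (cvg_comp _ _ c2).
exact: (continuous_pair (continuous_pair c3 c1) c4).
Qed.

Lemma lift_smooth i :
  smooth_on (lift_domain `&` lift_param @^-1` cdom (ambient_atlas M e i))
            (cmap (ambient_atlas M e i) \o lift_param).
Proof.
have [[oV cF] _ _ /(_ i) smF _] := PF.
pose S := V `&` F @^-1` cdom (poincare_atlas M e0 i).
have oS : open S by apply: open_param_domain => //; exact: open_poincare_dom.
pose O := [set z : 'rV[R]_(1 + k) | S (rsubmx z)].
have oO : open O by move/continuousP : (@continuous_rsubmx R 1 1 k); apply.
(* The coordinate formula is smooth for every sign of s, so it is enough to work on the preimage of
   an open set of [u]. *)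
suff smO : smooth_on O (cone_lift (fc i)).
  rewrite chart_lift => s z [Vz Dz]; apply: smO.
  by split; [case: Vz | exact: lift_cdom].
have /(smooth_on_mxP _ oS) sm := smF.
have smr : smooth_on O (fun z => rsubmx (fc i (rsubmx z)) 0 0).
  under eq_fun do rewrite mxE.
  exact: smooth_on_rsubmx (sm 0 (rshift n 0)).
have r0 z : O z -> rsubmx (fc i (rsubmx z)) 0 0 != 0.
  move=> [Vz Dz]; have [_ /andP[r_gt0 _]] := regular_param Vz Dz.
  by rewrite gt_eqF.
have sms : smooth_on O (fun z => lsubmx z 0 0).
  by apply: (smooth_on_eq oO _ (smooth_on_coord (lshift k 0))) => z _; rewrite mxE.
apply/(smooth_on_mxP _ oO) => a b; rewrite ord1.
case: (split_ordP b) => b' ->.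
  case: (split_ordP b') => c ->.
    apply: (smooth_on_eq oO _ (smooth_onM oO sms (smooth_onV oO r0 smr))) => z _.
    by rewrite /cone_lift !row_mxEl !ord1 [RHS]mxE mulr1n.
  apply: (smooth_on_eq oO _ (smooth_on_rsubmx (sm 0 (lshift 1 c)))) => z _.
  by rewrite /cone_lift [RHS]row_mxEl [RHS]row_mxEr [RHS]mxE.
have := smooth_onM oO (@smooth_on_cst _ _ _ O (- 2^-1 : R)) (smooth_onM oO smr smr).
apply: smooth_on_eq => // z _.
by rewrite /cone_lift row_mxEr !ord1 [RHS]mxE mulr1n /cst; field.
Qed.

(** Supplies the pointwise assumptions of the cone comparison: the metric ones from [corr], the
    regularity of [F] from [PF], and an invertible first form from positivity of g_+ and the rank of
    [F]. *)
Lemma cone_hypotheses i z : lift_domain z ->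
  cdom (ambient_atlas M e i) (lift_param z) ->
  first_form (ambient_metric grho i) (cmap (ambient_atlas M e i) \o lift_param) z
    \in unitmx /\
  (mean_curvature (ambient_metric grho i) (cmap (ambient_atlas M e i) \o lift_param) z = 0
   <-> mean_curvature (poincare_metric gr i) (fc i) (rsubmx z) = 0).
Proof.
move=> Vz Dz; have [s_gt0 Vu] := Vz; have Du := lift_cdom Vz Dz.
have [[oV cF] _ _ /(_ i) smF /(_ i _ Vu Du) rkF] := PF.
pose S := V `&` F @^-1` cdom (poincare_atlas M e0 i).
have oS : open S by apply: open_param_domain => //; exact: open_poincare_dom.
have Su : S (rsubmx z) by [].
have reg := regular_param Vu Du.
have r0 : rsubmx (fc i (rsubmx z)) 0 0 != 0.
  by have [_ /andP[r_gt0 _]] := reg; rewrite gt_eqF.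
have s0 : lsubmx z 0 0 != 0 by rewrite gt_eqF.
have df : {near rsubmx z, forall u, differentiable (fc i) u}.
  by apply: filterS (open_nbhs_nbhs (conj oS Su)) => y; exact: smooth_on_diff.
have ddf c j : differentiable (partial c (fun y => fc i y 0 j)) (rsubmx z).
  have /(smooth_on_mxP _ oS)/(_ 0 j)/(smooth_on_partial c) := smF.
  by move=> /smooth_on_diff; apply.
have grE := near_family_eq corr reg.
have dG := family_differentiable e0_gt0 e0e corr reg.
have [G0T _] := family_posdef e0_gt0 e0e corr reg.
have gpU := poincare_unit e0_gt0 e0e corr reg.
have hU : first_form (poincare_metric gr i) (fc i) (rsubmx z) \in unitmx.
  apply: posdef_gram_unit; first exact: poincare_posdef corr _ _ reg.
  by rewrite /row_free rkF.
rewrite chart_lift; split.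
  exact: (first_form_cone_unit r0 s0 df grE hU).
exact: (mean_curvature_cone_lift r0 s0 df ddf grE dG G0T gpU hU).
Qed.

Lemma local_param_lift :
  local_param (ambient_atlas M e) (homogeneous_lift e Y) lift_domain lift_param.
Proof.
have [[oV cF] [W oW FW] [G cG GK] _ _] := PF.
(* The image is saturated for the projection, so its relative openness is witnessed by the preimage
   of [W]. *)
have imE : lift_param @` lift_domain =
    homogeneous_lift e Y `&` @ambient_proj R n M @^-1` W.
  apply/seteqP; split=> [_ [z Vz <-]|q [hq Wq]].
    have [hz E] := lift_paramP Vz; split=> //=; rewrite E.
    have : (F @` V) (F (rsubmx z)) by exists (rsubmx z) => //; case: Vz.
    by rewrite FW; case.
  have : (F @` V) (ambient_proj q) by rewrite FW; split=> //; case: hq.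
  move=> [u Vu uE]; have [Vz zE] := lift_param_surj hq Vu uE.
  by eexists; [exact: Vz | exact: zE].
split.
- split; last exact: lift_param_continuous.
  have cs : continuous (fun z : 'rV[R]_(1 + k) => lsubmx z 0 0).
    move=> z; apply: differentiable_continuous.
    by have /differentiable_mxP := @differentiable_lsubmx R 1 1 k z.
  rewrite (_ : lift_domain = (fun z : 'rV[R]_(1 + k) => lsubmx z 0 0) @^-1` [set t | 0 < t]
      `&` @rsubmx R 1 1 k @^-1` V) //.
  apply: openI.
    by move/continuousP : cs; apply; exact: open_gt.
  by move/continuousP : (@continuous_rsubmx R 1 1 k); apply.
- exists (@ambient_proj R n M @^-1` W) => //.
  by move/continuousP : ambient_proj_continuous; apply.
(* The inverse reads s off as t r and the remaining parameters off the projection. *)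
- pose G' (q : R * M * R) : 'rV[R]_(1 + k) :=
    row_mx (q.1.1 * (ambient_proj q).2)%:M (G (ambient_proj q)).
  exists G'; last first.
    move=> z Vz; have [_ E] := lift_paramP Vz; have [_ Vu] := Vz.
    have /andP[r_gt0 _] := param_r Vu.
    rewrite /G' E GK // /lift_param /= divfK ?gt_eqF //.
    by rewrite -mx11_scalar hsubmxK.
  apply/subspace_continuousP => q qim.
  have cG' : G (ambient_proj y) @[y --> within (lift_param @` lift_domain) (nbhs q)]
      --> G (ambient_proj q).
    have qF : (F @` V) (ambient_proj q).
      by move: qim; rewrite imE FW => -[[_ Yq] Wq].
    move=> B nB.
    have nB1 : \forall p \near ambient_proj q, (F @` V) p -> B (G p).
      exact: ((subspace_continuousP _ _).1 cG _ qF B nB).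
    have nB' : \forall y \near q, (F @` V) (ambient_proj y) -> B (G (ambient_proj y)).
      exact: (@ambient_proj_continuous q _ nB1).
    suff : \forall y \near q, (lift_param @` lift_domain) y -> B (G (ambient_proj y)).
      by [].
    apply: filterS nB' => y By yim; apply: By.
    by move: yim; rewrite imE FW => -[[_ Yy] Wy].
  have cs : (y.1.1 * (ambient_proj y).2) @[y --> within (lift_param @` lift_domain) (nbhs q)]
      --> q.1.1 * (ambient_proj q).2.
    apply: cvg_within_filter; apply: cvgM.
      by apply: (@continuous_comp _ _ _ fst fst); exact: cvg_fst.
    apply: (@continuous_comp _ _ _ (@ambient_proj R n M) snd); last exact: cvg_snd.
    exact: ambient_proj_continuous.
  exact: cvg_row_mx_scalar.
- exact: lift_smooth.
(* The rank is obtained from the invertible first form, avoiding a direct computation with the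
   Jacobian of the lift. *)
- move=> i z Vz Dz; have [U _] := cone_hypotheses Vz Dz.
  move: U; rewrite /first_form -mulmxA => /mulmx_unit_row_free.
  by rewrite /row_free => /eqP.
Qed.

End LiftedParam.

Theorem proposition6p1 (R : realType) (n : nat) (M : manifold R n)
    (g : components R (mindex M) n)
    (e0 e : R) (gr grho : R -> components R (mindex M) n)
    (k : nat) (Y : set (M * R)%type) :
  riemannian_metric g ->
  0 < e0 -> 0 < e -> e0 ^+ 2 <= 2 * e ->
  even_poincare g e0 gr ->
  corresponding_ambient g e0 gr e grho ->
  (1 <= k <= n)%N ->
  submanifold (poincare_atlas M e0) k Y ->
  minimal (poincare_atlas M e0) (poincare_metric gr) k Y <->
  minimal (ambient_atlas M e) (ambient_metric grho) k.+1
    (homogeneous_lift e Y).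
Proof.
move=> _ e0_gt0 e_gt0 e0e _ corr _ subY.
have lift_at V F z : local_param (poincare_atlas M e0) Y V F ->
    lift_domain V z -> forall i, cdom (ambient_atlas M e i) (lift_param F z) ->
    _ := fun PF Vz i Dz => cone_hypotheses e0_gt0 e0e corr subY PF Vz Dz.
have liftP V F (PF : local_param (poincare_atlas M e0) Y V F) :=
  local_param_lift e0_gt0 e0e corr subY PF.
(* Through every point of the lift passes a cone parametrization, with which any other one can be
   compared there. *)
have lift_cover q : homogeneous_lift e Y q -> exists (V : set 'rV[R]_k) F z,
    [/\ local_param (poincare_atlas M e0) Y V F, lift_domain V z & lift_param F z = q].
  move=> hq; have [V [F [PF [u Vu uE]]]] := subY.2 _ hq.2.
  have [Vz zE] := lift_param_surj subY PF hq Vu uE.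
  by exists V, F; eexists; split; [exact: PF | exact: Vz | exact: zE].
split=> [[_ _ mcY]|[_ _ mcL]].
  (* Nondegeneracy and vanishing mean curvature are obtained together, both being transported from
     the cone parametrization through the same point. *)
  have point V' F' : local_param (ambient_atlas M e) (k := k.+1) (homogeneous_lift e Y) V' F' ->
      forall i u, V' u -> cdom (ambient_atlas M e i) (F' u) ->
      first_form (ambient_metric grho i) (cmap (ambient_atlas M e i) \o F') u \in unitmx /\
      mean_curvature (ambient_metric grho i) (cmap (ambient_atlas M e i) \o F') u = 0.
    move=> PF' i u Vu Du.
    have hq : homogeneous_lift e Y (F' u).
      have [_ [W _ FW] _ _ _] := PF'.
      have : (F' @` V') (F' u) by exists u.
      by rewrite FW; case.
    have [V [F [z [PF Vz zE]]]] := lift_cover _ hq.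
    have Dz : cdom (ambient_atlas M e i) (lift_param F z) by rewrite zE.
    have [U mcE] := lift_at V F z PF Vz i Dz.
    have [U' mc'] := mean_curvature_local_param PF' (liftP V F PF)
      (open_ambient_dom (i := i)) Vu Vz zE Du U.
    split=> //; apply: mc'; apply/mcE; apply: (mcY V F PF); first by case: Vz.
    exact: (lift_cdom subY PF Vz Dz).
  split.
  - split=> [q hq|q hq].
      have [[t_gt0 /andP[b1 b2]] Yq] := hq; have [i [Di r_itv]] := subY.1 _ Yq.
      by exists i; split=> //; rewrite b1 (le_lt_trans b2).
    have [V [F [z [PF Vz zE]]]] := lift_cover _ hq.
    exists (lift_domain V), (lift_param F); split; first exact: liftP.
    by exists z.
  - by move=> V' F' PF' i u Vu Du; have [] := point V' F' PF' i u Vu Du.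
  - by move=> V' F' PF' i u Vu Du; have [] := point V' F' PF' i u Vu Du.
have regular V F (PF : local_param (poincare_atlas M e0) Y V F) i u :
    V u -> cdom (poincare_atlas M e0 i) (F u) ->
    exists z : 'rV[R]_(1 + k), [/\ lift_domain V z, rsubmx z = u &
                  cdom (ambient_atlas M e i) (lift_param F z)].
  (* Any positive s would do; the slice s = 1 is taken. *)
  move=> Vu [Du r_itv]; exists (row_mx 1%:M u); rewrite row_mxKr.
  have Vz : lift_domain V (row_mx 1%:M u : 'rV[R]_(1 + k)).
    by rewrite /lift_domain /= row_mxKl row_mxKr [_%:M 0 0]mxE.
  split=> //; have [[[t_gt0 /andP[b1 b2]] _] _] := lift_paramP e0_gt0 e0e subY PF Vz.
  split=> //; first by rewrite /= row_mxKr.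
  by rewrite b1 (le_lt_trans b2).
(* Nondegeneracy of Y is automatic because g_+ is positive definite. *)
split=> // V F PF i u Vu Du.
  have [_ _ _ _ /(_ i _ Vu Du) rkF] := PF.
  apply: posdef_gram_unit; last by rewrite /row_free rkF.
  exact: (poincare_posdef e0_gt0 e0e corr (regular_param Vu Du)).
have [z [Vz <- Dz]] := regular V F PF i u Vu Du.
have [_ mcE] := lift_at V F z PF Vz i Dz.
by apply/mcE; apply: mcL (liftP V F PF) _ _ Vz Dz.
Qed.
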